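(* Consider a finite sequence $\{\mathbf{X}_j\}$ of independent, random, self-adjoint matrices with dimension $n$, all of which have zero mean. Let $\Psi:\bigcup_{1\le d\le n}\mathbb{V}^n_d\to\mathbb{R}$ be a function satisfying $$\max_j\lambda_{\max}(\mathbf{V}^*\mathbf{X}_j\mathbf{V})\le\Psi(\mathbf{V})\quad\text{almost surely, for each }\mathbf{V}\in\bigcup_{1\le d\le n}\mathbb{V}^n_d.$$ Given an integer $1\le k\le n$, define $$\sigma_k^2=\lambda_k\Big(\sum_j\mathbb{E}(\mathbf{X}_j^2)\Big),$$ and choose $\mathbf{V}_+\in\mathbb{V}^n_{n-k+1}$ to satisfy $$\sigma_k^2=\lambda_{\max}\Big(\sum_j\mathbf{V}_+^*\,\mathbb{E}(\mathbf{X}_j^2)\,\mathbf{V}_+\Big).$$ Assume $\sigma_k^2>0$ and $\Psi(\mathbf{V}_+)>0$. Let $h(u)=(1+u)\log(1+u)-u$ for $u\ge0$. Then, for all $t\ge0$, $$\mathbb{P}\Big\{\lambda_k\Big(\sum_j\mathbf{X}_j\Big)\ge t\Big\}\le(n-k+1)\cdot\exp\left\{-\frac{\sigma_k^2}{\Psi(\mathbf{V}_+)^2}\cdot h\left(\frac{\Psi(\mathbf{V}_+)\,t}{\sigma_k^2}\right)\right\}\tag{i}$$ $$\le(n-k+1)\cdot\exp\left\{\frac{-t^2/2}{\sigma_k^2+\Psi(\mathbf{V}_+)t/3}\right\}\tag{ii}$$ $$\le\begin{cases}(n-k+1)\cdot\exp\left\{-\tfrac38\,t^2/\sigma_k^2\right\}&\text{for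 }t\le\sigma_k^2/\Psi(\mathbf{V}_+),\\(n-k+1)\cdot\exp\left\{-\tfrac38\,t/\Psi(\mathbf{V}_+)\right\}&\text{for }t\ge\sigma_k^2/\Psi(\mathbf{V}_+).\end{cases}\tag{iii}$$
   Context: Matrices are complex. For $1\le d\le n$, $\mathbb{V}^n_d=\{\mathbf{V}\in\mathbb{C}^{n\times d}:\mathbf{V}^*\mathbf{V}=\mathbf{I}\}$ is the complex Stiefel manifold. Eigenvalues of a self-adjoint matrix are listed in weakly decreasing order $\lambda_{\max}=\lambda_1\ge\lambda_2\ge\cdots$. The expectations $\mathbb{E}(\mathbf{X}_j^2)$ appearing in the statement are assumed to exist (be finite). *)

(* Defs.v *)
From HB Require Import structures.
From mathcomp Require Import all_boot all_order all_algebra.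
From mathcomp Require Import sesquilinear spectral complex.
From mathcomp Require Import all_classical all_reals all_analysis.

Set Implicit Arguments.
Unset Strict Implicit.
Unset Printing Implicit Defensive.

Import Order.TTheory GRing.Theory Num.Theory.
Import numFieldNormedType.Exports.

Local Open Scope classical_set_scope.
Local Open Scope complex_scope.
Local Open Scope sesquilinear_scope.
Local Open Scope ring_scope.

(* The roots of the characteristic polynomial, with multiplicity, in weakly
   decreasing order. Taking real parts loses nothing on self-adjoint matrices,
   whose eigenvalues are real; on other matrices the value is meaningless. *)
Definition eigenvalues (R : realType) (n : nat) (A : 'M[R[i]]_n) : seq R :=
  sort (fun x y => y <= x)
    [seq complex.Re z | z <- sval (closed_field_poly_normal (char_poly A))].

(* Numbered from 1: [lambda 1] is the largest eigenvalue. *)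
Definition lambda (R : realType) (n : nat) (k : nat) (A : 'M[R[i]]_n) : R :=
  (eigenvalues A)`_k.-1.

Definition lambda_max (R : realType) (n : nat) (A : 'M[R[i]]_n) : R :=
  lambda 1 A.

Definition stiefel (R : realType) (n p : nat) : set 'M[R[i]]_(n, p) :=
  [set V | V ^t* *m V = 1%:M].

(* The Borel sigma-algebra of 'M[R[i]]_(m, n), seen as R^(2mn). *)
Definition mx_borel (R : realType) (m n : nat) : set (set 'M[R[i]]_(m, n)) :=
  <<s [set A : set 'M[R[i]]_(m, n) |
        exists (a : 'I_m) (b : 'I_n) (B : set R), measurable B /\
          (A = (fun M : 'M[R[i]]_(m, n) => complex.Re (M a b)) @^-1` B \/
           A = (fun M : 'M[R[i]]_(m, n) => complex.Im (M a b)) @^-1` B)] >>.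

Definition random_mx (R : realType) (d : measure_display)
    (Omega : measurableType d) (m n : nat) (X : Omega -> 'M[R[i]]_(m, n)) :
    Prop :=
  forall B, mx_borel B -> measurable (X @^-1` B).

Definition mutually_independent (R : realType) (d : measure_display)
    (Omega : measurableType d) (P : probability Omega R) (I : finType)
    (m n : nat) (X : I -> Omega -> 'M[R[i]]_(m, n)) : Prop :=
  forall (J : {set I}) (B : I -> set 'M[R[i]]_(m, n)),
    (forall j, mx_borel (B j)) ->
    P [set w | forall j, j \in J -> B j (X j w)] =
      (\prod_(j in J) P (X j @^-1` B j))%E.

Definition mx_integrable (R : realType) (d : measure_display)
    (Omega : measurableType d) (P : probability Omega R) (m n : nat)
    (X : Omega -> 'M[R[i]]_(m, n)) : Prop :=
  forall a b,
    P.-integrable setT (fun w => (complex.Re (X w a b))%:E) /\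
    P.-integrable setT (fun w => (complex.Im (X w a b))%:E).

(* The entrywise expectation; only meaningful when [mx_integrable P X]. *)
Definition mx_expectation (R : realType) (d : measure_display)
    (Omega : measurableType d) (P : probability Omega R) (m n : nat)
    (X : Omega -> 'M[R[i]]_(m, n)) : 'M[R[i]]_(m, n) :=
  \matrix_(a, b) (fine ('E_P[fun w => complex.Re (X w a b)]) +i*
                  fine ('E_P[fun w => complex.Im (X w a b)])).

Definition bennett (R : realType) (u : R) : R := (1 + u) * ln (1 + u) - u.

(* Main.v *)
Require Import Defs.
From HB Require Import structures.
From mathcomp Require Import all_boot all_order all_algebra.
From mathcomp Require Import sesquilinear spectral complex.
From mathcomp Require Import all_classical all_reals all_analysis.
From mathcomp Require Import ring lra measurable_realfun.

Set Implicit Arguments.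
Unset Strict Implicit.
Unset Printing Implicit Defensive.

Import Order.TTheory GRing.Theory Num.Theory.
Import numFieldNormedType.Exports.

Local Open Scope classical_set_scope.
Local Open Scope complex_scope.
Local Open Scope sesquilinear_scope.
Local Open Scope ring_scope.

(** With d = n - k + 1, Courant-Fischer and Markov's inequality reduce the tail
    of lambda_k to the trace moment generating function E tr exp(sum_j th Y_j)
    of the compressions Y_j = V^* X_j V.  No concavity theorem of Lieb's type is
    needed to bound it: if K is Hermitian and independent of Y_j, then, writing
    W_j = V^* E(X_j^2) V and g = (e^(th L) - 1 - th L) / L^2,
      E tr exp(K + th Y_j) <= E tr (exp K exp(th Y_j))
                           <= tr (E exp K * (1 + g W_j))
                           <= E tr exp(K + g W_j),
    by the Golden-Thompson inequality, the scalar bound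
    e^(th x) <= 1 + th x + g x^2 on x <= L (the middle expression is linear in
    the law of Y_j, whence the variance of the sum appears), and convexity of
    the trace exponential.  Replacing the summands th Y_j by g W_j one at a time
    gives E tr exp(sum_j th Y_j) <= tr exp(g sum_j W_j) <= d e^(g sigma_k^2),
    and th = ln(1 + L t / sigma_k^2) / L is optimal. *)

(** * Scalar inequalities *)

(** [fmx f A] is built from a diagonalisation chosen separately for each [A], with no control on how
    it varies with [A]. Golden-Thompson, the composition rule [fmx_expR_comp] and measurability
    therefore all pass through the polynomials [(1 + A / 2^k)^(2^k)], which involve no spectral data
    and converge to the exponential. Klein's inequality instead pairs two diagonalisations through
    the weights [overlap]. Golden-Thompson fails for three matrices; this is why all summands but
    one stay inside the single exponent [K]. The other obstacle is integrability of [exp K], which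
    the hypotheses do not give directly. Since [g W_j] is positive semidefinite, the trace of
    [exp K] is at most that of [exp (K + g W_j)], whose integrability the induction carries
    along. *)

Section Scalar.
Variable R : realType.
Implicit Types (x y u c : R).

Lemma is_derive_le (f df : R -> R) (a b : R) : a <= b ->
  (forall x, a <= x <= b -> is_derive x 1 f (df x)) ->
  (forall x, a < x < b -> 0 <= df x) -> f a <= f b.
Proof.
move=> ab fdf df0; rewrite -subr_ge0.
move: ab; rewrite le_eqVlt => /predU1P[->|ab]; first by rewrite subrr.
have [x xab|x|x xab ->] := @MVT R f df a b ab.
- by apply: fdf; move: xab; rewrite in_itv /= => /andP[/ltW -> /ltW ->].
- apply: derivable_within_continuous => y; rewrite in_itv /= => yab.
  by have := fdf y yab; case.
- by rewrite mulr_ge0 ?subr_ge0 ?(ltW ab)// df0 //; rewrite in_itv in xab.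
Qed.

Lemma bernoulli_ineq x k : 0 <= x <= 1 -> 1 - k%:R * x <= (1 - x) ^+ k.
Proof.
move=> /andP[x0 x1]; elim: k => [|k IH]; first by rewrite mul0r subr0 expr0.
rewrite exprS.
apply: le_trans (_ : (1 - x) * (1 - k%:R * x) <= _); last first.
  by rewrite ler_wpM2l // subr_ge0.
rewrite -natr1; have : 0 <= k%:R * x * x by rewrite !mulr_ge0.
nra.
Qed.

(** The exponent is a power of two because [rtr_pow2] reaches only those. As a polynomial in [x], it
    acts on a matrix through sums and products alone. *)
Definition euler k x := (1 + x / (2 ^ k)%:R) ^+ (2 ^ k).

Let pow2_gt0 k : 0 < (2 ^ k)%:R :> R.
Proof. by rewrite ltr0n expn_gt0. Qed.

(** With [h = x / 2^k], [expR h * (1 - h) <= 1] gives [expR h * (1 - h^2) <= 1 + h]; in the power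
    [2^k], Bernoulli turns [(1 - h^2)^(2^k)] into [1 - x^2 / 2^k]. *)
Lemma euler_ge x k : `|x| <= (2 ^ k)%:R ->
  expR x * (1 - x ^+ 2 / (2 ^ k)%:R) <= euler k x.
Proof.
move=> xk; rewrite /euler; set N := (2 ^ k)%N.
have N0 := pow2_gt0 k; rewrite -/N in xk N0 *.
have h1 : `|x / N%:R| <= 1.
  by rewrite normf_div (gtr0_norm N0) ler_pdivrMr // mul1r.
have := h1; rewrite ler_norml => /andP[hm hp].
have -> : expR x = expR (x / N%:R) ^+ N.
  by rewrite -expRM_natl mulrC divfK // gt_eqF.
apply: (@le_trans _ _ (expR (x / N%:R) ^+ N * (1 - (x / N%:R) ^+ 2) ^+ N)).
  rewrite ler_wpM2l ?exprn_ge0 ?expR_ge0 //.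
  apply: le_trans (bernoulli_ineq _ _); last first.
    by rewrite sqr_ge0 -real_normK ?num_real // expr_le1.
  by rewrite expr_div_n mulrCA [N%:R ^+ 2]expr2 invfM (mulrA N%:R) divff
    ?gt_eqF // mul1r.
rewrite -exprMn lerXn2r ?nnegrE //.
- by rewrite mulr_ge0 ?expR_ge0 // subr_ge0 -real_normK ?num_real // expr_le1.
- by rewrite -lerBlDl sub0r.
set h := x / N%:R in hm hp *.
have : expR h * (1 - h) <= 1.
  rewrite -[leRHS](expRxMexpNx_1 h) ler_wpM2l ?expR_ge0 //; exact: expR_ge1Dx.
have : 0 <= 1 + h by rewrite -lerBlDl sub0r.
nra.
Qed.

Lemma euler_le x k : `|x| <= (2 ^ k)%:R -> euler k x <= expR x.
Proof.
move=> xk; have N0 := pow2_gt0 k.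
have -> : expR x = expR (x / (2 ^ k)%:R) ^+ (2 ^ k).
  by rewrite -expRM_natl mulrC divfK // gt_eqF.
rewrite lerXn2r ?nnegrE ?expR_ge0 ?expR_ge1Dx //.
have : `|x / (2 ^ k)%:R| <= 1.
  by rewrite normf_div (gtr0_norm N0) ler_pdivrMr // mul1r.
by rewrite ler_norml => /andP[hm _]; rewrite -lerBlDl sub0r.
Qed.

Lemma cvg_div_pow2 x : x / (2 ^ k)%:R @[k --> \oo] --> (0 : R).
Proof.
have := @cvg_geometric R x (2^-1); rewrite ger0_norm ?invr_ge0 // => H.
apply: cvg_trans (H _); last by rewrite invf_lt1 // ltr1n.
by apply: near_eq_cvg; near=> k; rewrite /geometric /= exprVn natrX.
Unshelve. all: by end_near. Qed.

Lemma cvg_euler x : euler k x @[k --> \oo] --> expR x.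
Proof.
have nk : \forall k \near \oo, `|x| <= (2 ^ k)%:R.
  near=> k; have : `|x| / (2 ^ k)%:R < 1.
    near: k; exact: (cvgr_lt _ (cvg_div_pow2 `|x|) _ (@ltr01 R)).
  by rewrite ltr_pdivrMr // mul1r => /ltW.
apply: (@squeeze_cvgr _ _ _ _ (fun k => expR x * (1 - x ^+ 2 / (2 ^ k)%:R))
  (fun=> expR x)); last exact: cvg_cst.
  by apply: filterS nk => k xk; rewrite euler_ge // euler_le.
have H : expR x * (1 - x ^+ 2 / (2 ^ k)%:R) @[k --> \oo] --> expR x * (1 - 0).
  apply: cvgM; first exact: cvg_cst.
  by apply: cvgB; [exact: cvg_cst|exact: cvg_div_pow2].
by rewrite subr0 mulr1 in H.
Unshelve. all: by end_near. Qed.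

(** [expR z - 1 - z - z^2 / 2] vanishes at 0 and has the nonnegative derivative [expR z - 1 - z];
    this lemma and the next are the two sides of 0. *)
Lemma expR_taylor2_neg y : y <= 0 -> expR y - 1 - y <= y ^+ 2 / 2.
Proof.
move=> y0.
have := @is_derive_le (fun z => expR z - 1 - z - z ^+ 2 / 2)
  (fun z => expR z - 1 - z) y 0 y0.
rewrite expR0 expr0n /= => H.
have : expR y - 1 - y - y ^+ 2 / 2 <= 1 - 1 - 0 - 0 / 2.
  apply: H => [z _|z _]; last by rewrite -addrA -opprD subr_ge0 expR_ge1Dx.
  by apply: is_derive_eq; rewrite /GRing.scale /=; field.
lra.
Qed.

Lemma expR_taylor2_pos y : 0 <= y -> y ^+ 2 / 2 <= expR y - 1 - y.
Proof.
move=> y0.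
have := @is_derive_le (fun z => expR z - 1 - z - z ^+ 2 / 2)
  (fun z => expR z - 1 - z) 0 y y0.
rewrite expR0 expr0n /= => H.
have : 1 - 1 - 0 - 0 / 2 <= expR y - 1 - y - y ^+ 2 / 2.
  apply: H => [z _|z _]; last by rewrite -addrA -opprD subr_ge0 expR_ge1Dx.
  by apply: is_derive_eq; rewrite /GRing.scale /=; field.
lra.
Qed.

(** The difference of the sides is [y^3] times the derivative of [(expR y - 1 - y) / y^2]. Its own
    derivative [z * expR z - expR z + 1] is nonnegative because [expR (- z) >= 1 - z]. *)
Lemma expR_taylor2_psi y : 0 <= y -> 2 * (expR y - 1 - y) <= y * (expR y - 1).
Proof.
move=> y0.
have := @is_derive_le (fun z => z * (expR z - 1) - 2 * (expR z - 1 - z))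
  (fun z => z * expR z - expR z + 1) 0 y y0.
rewrite expR0 => H; rewrite -subr_ge0; apply: le_trans (H _ _).
- by rewrite mul0r subrr subr0 mulr0 subr0.
- move=> z _; apply: is_derive_eq; rewrite /GRing.scale /=; ring.
move=> z _; have := expR_ge1Dx (- z); have := expRxMexpNx_1 z.
have := expR_gt0 z; nra.
Qed.

(* (e^y - 1 - y) / y^2 is nondecreasing. *)
Lemma expR_taylor2_le y c : 0 < c -> y <= c ->
  expR y <= 1 + y + (expR c - 1 - c) / c ^+ 2 * y ^+ 2.
Proof.
move=> c0 yc; set phi := (_ / _).
suff : expR y - 1 - y <= phi * y ^+ 2 by lra.
have phic : phi * c ^+ 2 = expR c - 1 - c.
  by rewrite divfK // expf_eq0 /= gt_eqF.
(* The quotient by [y^2] is singular at 0, so a nonpositive [y] is compared with [c] through the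
   limit 1/2 there: the quotient is at most 1/2 left of 0 and at least 1/2 at [c]. *)
have [y0|y0] := leP y 0.
  apply: (le_trans (expR_taylor2_neg y0)).
  have : 1 / 2 <= phi.
    rewrite ler_pdivlMr ?exprn_gt0 //; have := expR_taylor2_pos (ltW c0); lra.
  have := sqr_ge0 y; nra.
pose f (z : R) : R := (expR z - 1 - z) / z ^+ 2.
have fyc : f y <= f c.
  apply: (@is_derive_le f
    (fun z => (z * (expR z - 1) - 2 * (expR z - 1 - z)) / z ^+ 3) _ _ yc).
    move=> z /andP[yz _].
    have z0 : z != 0 by rewrite gt_eqF // (lt_le_trans y0).
    have z20 : z ^+ 2 != 0 by rewrite expf_eq0.
    by apply: is_derive_eq; rewrite /GRing.scale /=; field.
  move=> z /andP[yz _]; have z0 := lt_trans y0 yz.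
  rewrite divr_ge0 ?exprn_ge0 ?(ltW z0) // subr_ge0.
  exact: (expR_taylor2_psi (ltW z0)).
by rewrite -ler_pdivrMr ?exprn_gt0.
Qed.

Lemma is_derive_ln1D x : 0 < 1 + x ->
  is_derive x 1 (fun z : R => ln (1 + z)) (1 + x)^-1.
Proof.
move=> x1; have := is_derive1_ln x1 => dln.
have d1 : is_derive x 1 (fun z : R => 1 + z) 1.
  by apply: is_derive_eq; rewrite add0r mulr1.
by have := @is_derive1_comp R _ _ x _ _ dln d1; rewrite mulr1.
Qed.

(** The left side is [3 u^2 / (6 + 2 u)]. The difference vanishes at 0, and its derivative,
    [ln (1 + z)] minus a rational function, vanishes at 0 as well; one more derivative leaves
    [(3 + z)^3 >= 27 (1 + z)]. *)
Lemma bennett_ge u : 0 <= u -> u ^+ 2 / 2 / (1 + u / 3) <= bennett u.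
Proof.
move=> u0.
have d1 x : 0 <= x -> 18 * x + 3 * x ^+ 2 <= 2 * (3 + x) ^+ 2 * ln (1 + x).
  move=> x0.
  pose f (z : R) : R := ln (1 + z) - 3 / 2 * (1 - 9 / (3 + z) ^+ 2).
  have : f 0 <= f x.
    apply: (@is_derive_le f (fun z => (1 + z)^-1 - 27 / (3 + z) ^+ 3) _ _ x0).
      move=> z /andP[z0 _].
      have z1 : 0 < 1 + z by lra.
      have z3 : 3 + z != 0 by apply: lt0r_neq0; lra.
      have z32 : (3 + z) ^+ 2 != 0 by rewrite expf_eq0.
      have dln := is_derive_ln1D z1.
      apply: is_derive_eq; rewrite /GRing.scale /=; field.
      by rewrite z3 gt_eqF.
    move=> z /andP[z0 _].
    rewrite subr_ge0 ler_pdivrMr; last by apply: exprn_gt0; lra.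
    rewrite mulrC ler_pdivlMr; last lra.
    have := sqr_ge0 z; nra.
  rewrite /f addr0 ln1 addr0 => H.
  have x3 : 0 < 3 + x by lra.
  have -> : 18 * x + 3 * x ^+ 2 = 2 * (3 + x) ^+ 2 *
      (3 / 2 * (1 - 9 / (3 + x) ^+ 2)).
    by field; exact: lt0r_neq0.
  rewrite ler_wpM2l //; last by lra.
  by have := sqr_ge0 (3 + x); lra.
pose f (z : R) : R := bennett z - 3 * z ^+ 2 / (6 + 2 * z).
have : f 0 <= f u.
  apply: (@is_derive_le f
    (fun z => ln (1 + z) - (18 * z + 3 * z ^+ 2) / (2 * (3 + z) ^+ 2)) _ _ u0).
    move=> z /andP[z0 _]; rewrite /f /bennett.
    have z1 : 0 < 1 + z by lra.
    have z3 : 3 + z != 0 by apply: lt0r_neq0; lra.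
    have dln := is_derive_ln1D z1.
    have z6 : 6 + 2 * z != 0 by apply: lt0r_neq0; lra.
    apply: is_derive_eq; rewrite /GRing.scale /=; field.
    by rewrite z3 z6 gt_eqF.
  move=> z /andP[z0 _]; rewrite subr_ge0 ler_pdivrMr.
    rewrite [leRHS]mulrC; apply: d1; exact: ltW.
  by rewrite mulr_gt0 // exprn_gt0 //; lra.
rewrite /f /bennett addr0 ln1 mulr0 expr0n /= mulr0 mul0r !subr0 subr_ge0.
suff -> : 3 * u ^+ 2 / (6 + 2 * u) = u ^+ 2 / 2 / (1 + u / 3) by [].
by field; apply/andP; split; apply: lt0r_neq0; lra.
Qed.
End Scalar.

(** * Traces of products of Hermitian matrices *)

Section ComplexParts.
Variable R : realType.
Implicit Types (x y : R[i]) (a : R).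

Lemma ReD x y : complex.Re (x + y) = complex.Re x + complex.Re y.
Proof. by case: x; case: y. Qed.

Lemma ReN x : complex.Re (- x) = - complex.Re x.
Proof. by case: x. Qed.

Lemma ImD x y : complex.Im (x + y) = complex.Im x + complex.Im y.
Proof. by case: x; case: y. Qed.

Lemma ReMc x y : complex.Re (x * y) =
  complex.Re x * complex.Re y - complex.Im x * complex.Im y.
Proof. by case: x; case: y. Qed.

Lemma ImMc x y : complex.Im (x * y) =
  complex.Re x * complex.Im y + complex.Im x * complex.Re y.
Proof. by case: x => a b; case: y => c d /=. Qed.

Lemma ReZ a x : complex.Re (a%:C * x) = a * complex.Re x.
Proof. by case: x => b c /=; rewrite mul0r subr0. Qed.

Lemma ImZ a x : complex.Im (a%:C * x) = a * complex.Im x.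
Proof. by case: x => b c /=; rewrite mul0r addr0. Qed.

Lemma Re_sum (I : Type) (r : seq I) (Q : pred I) (F : I -> R[i]) :
  complex.Re (\sum_(i <- r | Q i) F i) = \sum_(i <- r | Q i) complex.Re (F i).
Proof. exact: (big_morph (@complex.Re R) ReD). Qed.

Lemma Im_sum (I : Type) (r : seq I) (Q : pred I) (F : I -> R[i]) :
  complex.Im (\sum_(i <- r | Q i) F i) = \sum_(i <- r | Q i) complex.Im (F i).
Proof. exact: (big_morph (@complex.Im R) ImD). Qed.

Lemma conjE x : (x^* = x^*%C)%R.
Proof. by []. Qed.

Lemma Re_conjc x : complex.Re x^*%R = complex.Re x.
Proof. by rewrite conjE; case: x. Qed.

Lemma Im_conjc x : complex.Im x^*%R = - complex.Im x.
Proof. by rewrite conjE; case: x. Qed.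

Lemma conjCR a : (a%:C^*)%R = a%:C.
Proof. by rewrite conjE conjc_real. Qed.

Lemma Re_mulJ x :
  complex.Re (x * x^*%R) = complex.Re x ^+ 2 + complex.Im x ^+ 2.
Proof. rewrite ReMc Re_conjc Im_conjc; ring. Qed.

Lemma Re_ge0 x : 0 <= x -> 0 <= complex.Re x.
Proof. by rewrite lecE /= => /andP[]. Qed.
End ComplexParts.

Section Trace.
Variable R : realType.
Local Notation C := R[i].

Definition rtr n (A : 'M[C]_n) : R := complex.Re (\tr A).

Lemma rtrD n (A B : 'M[C]_n) : rtr (A + B) = rtr A + rtr B.
Proof. by rewrite /rtr mxtraceD ReD. Qed.

Lemma rtrN n (A : 'M[C]_n) : rtr (- A) = - rtr A.
Proof. by rewrite /rtr raddfN /= ReN. Qed.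

Lemma rtrB n (A B : 'M[C]_n) : rtr (A - B) = rtr A - rtr B.
Proof. by rewrite rtrD rtrN. Qed.

Lemma rtrC m n (A : 'M[C]_(m, n)) (B : 'M[C]_(n, m)) :
  rtr (A *m B) = rtr (B *m A).
Proof. by rewrite /rtr mxtrace_mulC. Qed.

Lemma trmxCM m n p (A : 'M[C]_(m, n)) (B : 'M[C]_(n, p)) :
  (A *m B)^t* = B^t* *m A^t*.
Proof. by rewrite trmx_mul map_mxM. Qed.

Lemma trmxCD m n (A B : 'M[C]_(m, n)) : (A + B)^t* = A^t* + B^t*.
Proof. by rewrite linearD /= map_mxD. Qed.

Lemma trmxCN m n (A : 'M[C]_(m, n)) : (- A)^t* = - A^t*.
Proof. by rewrite linearN /= map_mxN. Qed.

Lemma trmxCB m n (A B : 'M[C]_(m, n)) : (A - B)^t* = A^t* - B^t*.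
Proof. by rewrite trmxCD trmxCN. Qed.

Lemma trmxCZ m n (a : R) (A : 'M[C]_(m, n)) : (a%:C *: A)^t* = a%:C *: A^t*.
Proof. by apply/matrixP => i j; rewrite !mxE rmorphM /= conjCR. Qed.

Lemma trmxC1 n : (1%:M : 'M[C]_n)^t* = 1%:M.
Proof. by rewrite trmx1 map_mx1. Qed.

Lemma trmxCX n (A : 'M[C]_n) k : (A ^+ k)^t* = (A^t*) ^+ k.
Proof.
elim: k => [|k IH]; first by rewrite !expr0 trmxC1.
by rewrite exprS exprSr -!mulmxE trmxCM IH.
Qed.

Lemma rtr_trmxC n (A : 'M[C]_n) : rtr (A^t*) = rtr A.
Proof.
rewrite /rtr /mxtrace !Re_sum; apply: eq_bigr => i _.
by rewrite !mxE Re_conjc.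
Qed.

Lemma rtr_mulJ_ge0 n (A : 'M[C]_n) : 0 <= rtr (A *m A^t*).
Proof.
rewrite /rtr /mxtrace Re_sum; apply: sumr_ge0 => i _.
rewrite mxE Re_sum; apply: sumr_ge0 => j _.
by rewrite !mxE Re_mulJ addr_ge0 // sqr_ge0.
Qed.

Definition herm n (A : 'M[C]_n) := A^t* = A.

Lemma hermP n (A : 'M[C]_n) : A \is hermsymmx <-> herm A.
Proof.
split => [/is_hermitianmxP|]; first by rewrite expr0 scale1r => /esym.
by move=> AA; apply/is_hermitianmxP; rewrite expr0 scale1r AA.
Qed.

Lemma hermD n (A B : 'M[C]_n) : herm A -> herm B -> herm (A + B).
Proof. by rewrite /herm trmxCD => -> ->. Qed.

Lemma hermZ n (a : R) (A : 'M[C]_n) : herm A -> herm (a%:C *: A).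
Proof. by rewrite /herm trmxCZ => ->. Qed.

Lemma herm1 n : herm (1%:M : 'M[C]_n).
Proof. exact: trmxC1. Qed.

Lemma herm0 n : herm (0 : 'M[C]_n).
Proof. by rewrite /herm trmx0 map_mx0. Qed.

Lemma herm_sum n (I : Type) (r : seq I) (Q : pred I) (F : I -> 'M[C]_n) :
  (forall i, Q i -> herm (F i)) -> herm (\sum_(i <- r | Q i) F i).
Proof. by move=> FH; apply: big_ind => //; [exact: herm0|exact: hermD]. Qed.

Lemma herm_conj m n (V : 'M[C]_(m, n)) (A : 'M[C]_m) :
  herm A -> herm (V^t* *m A *m V).
Proof. by rewrite /herm !trmxCM trmxCK mulmxA => ->. Qed.

Lemma hermX n (A : 'M[C]_n) k : herm A -> herm (A ^+ k).
Proof. by rewrite /herm trmxCX => ->. Qed.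

Lemma rtr_mulXC n (A B : 'M[C]_n) k : rtr ((A *m B) ^+ k) = rtr ((B *m A) ^+ k).
Proof.
case: k => [|k]; first by rewrite !expr0.
have H j : (A *m B) ^+ j *m A = A *m (B *m A) ^+ j.
  elim: j => [|j IH]; first by rewrite !expr0 mul1mx mulmx1.
  rewrite !exprSr -!mulmxE -(mulmxA _ (A *m B)) -(mulmxA A) mulmxA IH.
  by rewrite -mulmxA.
by rewrite exprSr -mulmxE mulmxA H rtrC mulmxA exprS.
Qed.

Lemma rtr_rotX n (A B D : 'M[C]_n) k :
  rtr ((A *m (B *m D)) ^+ k) = rtr ((D *m A *m B) ^+ k).
Proof. by rewrite rtr_mulXC -mulmxA rtr_mulXC. Qed.

(** Expansion of the squared Frobenius norm of [M - M^t*]. *)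
Lemma rtr_sqr_le n (M : 'M[C]_n) : rtr (M *m M) <= rtr (M *m M^t*).
Proof.
have := rtr_mulJ_ge0 (M - M^t*).
rewrite trmxCB trmxCK mulmxBl !mulmxBr !rtrB.
rewrite (rtrC (M^t*) M) -(trmxCM M M) rtr_trmxC.
lra.
Qed.

Lemma rtr_hermM_le n (A B : 'M[C]_n) : herm A -> herm B ->
  rtr (A *m B) <= (rtr (A *m A) + rtr (B *m B)) / 2.
Proof.
move=> hA hB; have := rtr_mulJ_ge0 (A - B).
rewrite trmxCB hA hB mulmxBl !mulmxBr !rtrB (rtrC B A).
lra.
Qed.

(* The algebraic core of the Golden-Thompson inequality.  The two statements
   feed each other: the first at M^2 reduces to the second for M^* M and M M^*,
   and the second at k + 1 reduces to the first for A B. *)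
Lemma rtr_pow2 n k :
  (forall M : 'M[C]_n,
     rtr (M ^+ (2 ^ k.+1)) <= rtr ((M *m M^t*) ^+ (2 ^ k))) /\
  (forall A B : 'M[C]_n, herm A -> herm B ->
     rtr ((A *m B) ^+ (2 ^ k)) <= rtr (A ^+ (2 ^ k) *m B ^+ (2 ^ k))).
Proof.
elim: k => [|k [S G]].
  by split=> [M|A B _ _]; rewrite ?expn1 ?expn0 !expr1 // expr2 rtr_sqr_le.
have hMM (M : 'M[C]_n) : herm (M *m M^t*) by rewrite /herm trmxCM trmxCK.
split=> [M|A B hA hB].
  rewrite expnS exprM.
  apply: (le_trans (S _)).
  have -> : rtr ((M ^+ 2 *m (M ^+ 2)^t*) ^+ (2 ^ k)) =
            rtr (((M^t* *m M) *m (M *m M^t*)) ^+ (2 ^ k)).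
    have -> : M ^+ 2 *m (M ^+ 2)^t* = M *m (M *m M^t* *m M^t*).
      by rewrite expr2 -mulmxE trmxCM !mulmxA.
    exact: rtr_rotX.
  apply: (le_trans (G _ _ _ (hMM M))).
    by rewrite -{2}(trmxCK M); exact: hMM.
  (* [M^t* *m M] and [M *m M^t*] have powers of equal trace, so the mean produced here is the right
     side itself. *)
  apply: le_trans (rtr_hermM_le _ _) _; [| exact/hermX/hMM|].
    by apply: hermX; rewrite /herm trmxCM trmxCK.
  rewrite mulmxE -!exprD !addnn -!mul2n -expnS rtr_mulXC.
  lra.
apply: (le_trans (S _)).
have -> : rtr (((A *m B) *m (A *m B)^t*) ^+ (2 ^ k)) =
          rtr (((A *m A) *m (B *m B)) ^+ (2 ^ k)).
  have -> : (A *m B) *m (A *m B)^t* = A *m (B *m B *m A).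
    by rewrite trmxCM hA hB !mulmxA.
  exact: rtr_rotX.
apply: le_trans (G _ _ _ _) _; rewrite /herm ?trmxCM ?hA ?hB //.
by rewrite !mulmxE -!expr2 -!exprM -expnS.
Qed.
End Trace.

(** * Functional calculus and trace inequalities *)

Section Calculus.
Variable R : realType.
Local Notation C := R[i].

(** Eigenvalues in the order of the chosen diagonalisation, unsorted; [eigenvalues_perm] matches
    them with the sorted roots of the characteristic polynomial. On Hermitian matrices the diagonal
    is real. *)
Definition eig n (A : 'M[C]_n) (i : 'I_n) : R :=
  complex.Re (spectral_diag A 0 i).

Definition spectral_diagmx n (A : 'M[C]_n) (s : 'rV[C]_n) : 'M[C]_n :=
  (spectralmx A)^t* *m diag_mx s *m spectralmx A.

(* Only meaningful on Hermitian matrices. *)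
Definition fmx (f : R -> R) n (A : 'M[C]_n) : 'M[C]_n :=
  spectral_diagmx A (\row_i (f (eig A i))%:C).

Lemma spectral_mulJ n (A : 'M[C]_n) : spectralmx A *m (spectralmx A)^t* = 1%:M.
Proof. exact/unitarymxP/spectral_unitarymx. Qed.

Lemma spectral_mulJl n (A : 'M[C]_n) : (spectralmx A)^t* *m spectralmx A = 1%:M.
Proof. exact/mulmx1C/spectral_mulJ. Qed.

Lemma fmx_ext f g n (A : 'M[C]_n) : (forall i, f (eig A i) = g (eig A i)) ->
  fmx f A = fmx g A.
Proof.
move=> fg; congr spectral_diagmx.
by apply/rowP => i; rewrite !mxE fg.
Qed.

Lemma fmx_id n (A : 'M[C]_n) : herm A -> fmx id A = A.
Proof.
move=> /hermP hA.
have /orthomx_spectralP AE := hermitian_normalmx hA.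
rewrite [RHS]AE (invmx_unitary (spectral_unitarymx A)).
rewrite -[RHS]/(spectral_diagmx A (spectral_diag A)).
congr spectral_diagmx; apply/rowP => i; rewrite !mxE.
have /mxOverP /(_ 0 i) := hermitian_spectral_diag_real hA.
exact: RRe_real.
Qed.

Lemma fmxM f g n (A : 'M[C]_n) :
  fmx f A *m fmx g A = fmx (fun x => f x * g x) A.
Proof.
rewrite /fmx /spectral_diagmx !mulmxA -(mulmxA _ (spectralmx A)) spectral_mulJ.
rewrite mulmx1.
rewrite -(mulmxA _ (diag_mx _) (diag_mx _)) mulmx_diag.
rewrite -[LHS]/(spectral_diagmx A _).
by congr spectral_diagmx; apply/rowP => i; rewrite !mxE rmorphM.
Qed.

Lemma fmx1 n (A : 'M[C]_n) : fmx (fun=> 1) A = 1%:M.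
Proof.
rewrite /fmx /spectral_diagmx (_ : diag_mx _ = 1%:M) ?mulmx1 ?spectral_mulJl //.
by rewrite -diag_const_mx; congr diag_mx; apply/rowP => i; rewrite !mxE.
Qed.

Lemma fmxD f g n (A : 'M[C]_n) : fmx f A + fmx g A = fmx (fun x => f x + g x) A.
Proof.
rewrite /fmx /spectral_diagmx -mulmxDl -mulmxDr -raddfD.
rewrite -[LHS]/(spectral_diagmx A _).
by congr spectral_diagmx; apply/rowP => i; rewrite !mxE rmorphD.
Qed.

Lemma fmxZ f (a : R) n (A : 'M[C]_n) :
  a%:C *: fmx f A = fmx (fun x => a * f x) A.
Proof.
rewrite /fmx /spectral_diagmx scalemxAl scalemxAr -linearZ.
rewrite -[LHS]/(spectral_diagmx A _).
by congr spectral_diagmx; apply/rowP => i; rewrite !mxE rmorphM.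
Qed.

Lemma fmxX f k n (A : 'M[C]_n) : fmx f A ^+ k = fmx (fun x => f x ^+ k) A.
Proof.
elim: k => [|k IH].
  by rewrite expr0 -[LHS](fmx1 A); apply: fmx_ext => i; rewrite expr0.
by rewrite exprS -mulmxE IH fmxM; apply: fmx_ext => i; rewrite exprS.
Qed.

Lemma fmx_herm f n (A : 'M[C]_n) : herm (fmx f A).
Proof.
rewrite /fmx /spectral_diagmx; apply: herm_conj.
rewrite /herm tr_diag_mx map_diag_mx.
by congr diag_mx; apply/rowP => i; rewrite !mxE /= conjCR.
Qed.

Lemma fmxE f n (A : 'M[C]_n) a b : fmx f A a b =
  \sum_i (f (eig A i))%:C * ((spectralmx A i a)^* * spectralmx A i b)%R.
Proof.
rewrite /fmx /spectral_diagmx mul_mx_diag mxE; apply: eq_bigr => i _.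
by rewrite !mxE; ring.
Qed.

Lemma tr_fmxM f n (A B : 'M[C]_n) : \tr (fmx f A *m B) =
  \sum_i (f (eig A i))%:C *
    (row i (spectralmx A) *m B *m (row i (spectralmx A))^t*) 0 0.
Proof.
rewrite /fmx /spectral_diagmx -!mulmxA mxtrace_mulC -!mulmxA mul_diag_mx.
rewrite /mxtrace; apply: eq_bigr => i _.
rewrite -mulmxA [in LHS]mxE [(\row__ _) _ _]mxE; congr (_ * _).
rewrite !mxE; apply: eq_bigr => j _; rewrite !mxE; congr (_ * _).
by apply: eq_bigr => k _; rewrite !mxE.
Qed.

Lemma rtr_fmx f n (A : 'M[C]_n) : rtr (fmx f A) = \sum_i f (eig A i).
Proof.
rewrite /rtr /fmx /spectral_diagmx mxtrace_mulC mulmxA spectral_mulJ mul1mx.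
rewrite mxtrace_diag Re_sum.
by apply: eq_bigr => i _; rewrite mxE.
Qed.

Definition psd n (A : 'M[C]_n) :=
  forall x : 'rV[C]_n, 0 <= (x *m A *m x^t*) 0 0.

Lemma psd_mulJ m n (A : 'M[C]_(m, n)) : psd (A *m A^t*).
Proof.
move=> x; rewrite mulmxA -mulmxA -trmxCM mxE; apply: sumr_ge0 => i _.
by rewrite !mxE mul_conjC_ge0.
Qed.

Lemma rtr_fmxM_ge0 f n (A B : 'M[C]_n) : (forall x, 0 <= f x) -> psd B ->
  0 <= rtr (fmx f A *m B).
Proof.
move=> f0 B0; rewrite /rtr tr_fmxM Re_sum; apply: sumr_ge0 => i _.
by rewrite ReZ mulr_ge0 // Re_ge0.
Qed.

Lemma psd_fmx f n (A : 'M[C]_n) : (forall i, 0 <= f (eig A i)) -> psd (fmx f A).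
Proof.
move=> f0; have -> : fmx f A = fmx (fun x => Num.sqrt (f x)) A *m
    (fmx (fun x => Num.sqrt (f x)) A)^t*.
  rewrite fmx_herm fmxM; apply: fmx_ext => i.
  by rewrite -expr2 sqr_sqrtr.
exact: psd_mulJ.
Qed.

(** Squared modulus of the inner product of the i-th eigenvector of [A] and the j-th of [B]. With
    these nonnegative weights a trace inequality for functions of [A] and [B] reduces to a scalar
    inequality between pairs of eigenvalues. *)
Definition overlap n (A B : 'M[C]_n) i j : R :=
  let z := (row i (spectralmx A) *m (row j (spectralmx B))^t*) 0 0 in
  complex.Re (z * z^*).

Lemma overlap_ge0 n (A B : 'M[C]_n) i j : 0 <= overlap A B i j.
Proof. by rewrite /overlap Re_mulJ addr_ge0 ?sqr_ge0. Qed.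

Lemma rtr_fmx_fmx f g n (A B : 'M[C]_n) : rtr (fmx f A *m fmx g B) =
  \sum_i \sum_j f (eig A i) * g (eig B j) * overlap A B i j.
Proof.
rewrite /rtr tr_fmxM Re_sum; apply: eq_bigr => i _.
rewrite ReZ /fmx /spectral_diagmx.
set x := row i _; set Q := spectralmx B.
rewrite !mulmxA -mulmxA -{2}(trmxCK Q) -trmxCM mul_mx_diag mxE Re_sum mulr_sumr.
apply: eq_bigr => j _; rewrite /overlap -/x -/Q.
have -> : (x *m (row j Q)^t*) 0 0 = (x *m Q^t*) 0 j.
  by rewrite !mxE; apply: eq_bigr => k _; rewrite !mxE.
rewrite -mulrA -[in RHS]ReZ; congr (_ * complex.Re _).
rewrite [(\matrix_(_, _) _) _ _]mxE [(\row__ _) _ _]mxE.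
rewrite [((x *m Q^t*)^t*) _ _]mxE [((x *m Q^t*)^T) _ _]mxE.
by rewrite mulrAC mulrC.
Qed.
End Calculus.

(** * Limits of traces, Golden-Thompson and Klein inequalities *)

Section TraceInequalities.
Variable R : realType.
Local Notation C := R[i].
Import Normc.

Lemma cvg_fsum (I : finType) (u : I -> nat -> R) (l : I -> R) :
  (forall i, u i k @[k --> \oo] --> l i) ->
  \sum_i u i k @[k --> \oo] --> \sum_i l i.
Proof. by move=> ul; apply: cvg_big => //; exact: add_continuous. Qed.

Lemma cvg_ext (u v : nat -> R) (l m : R) : u =1 v -> l = m ->
  v k @[k --> \oo] --> m -> u k @[k --> \oo] --> l.
Proof. by move=> uv ->; rewrite (funext uv). Qed.

Lemma cvg_rtr_fmx_fmx (f g : nat -> R -> R) (f' g' : R -> R) n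
    (A B : 'M[C]_n) :
  (forall x, f k x @[k --> \oo] --> f' x) ->
  (forall x, g k x @[k --> \oo] --> g' x) ->
  rtr (fmx (f k) A *m fmx (g k) B) @[k --> \oo] --> rtr (fmx f' A *m fmx g' B).
Proof.
move=> ff gg.
apply: (cvg_ext (fun k => rtr_fmx_fmx (f k) (g k) A B) (rtr_fmx_fmx f' g' A B)).
apply: cvg_fsum => i; apply: cvg_fsum => j.
by apply: cvgM; [apply: cvgM|exact: cvg_cst].
Qed.

Lemma cvg_rtr_fmx (f : nat -> R -> R) (f' : R -> R) n (A : 'M[C]_n) :
  (forall x, f k x @[k --> \oo] --> f' x) ->
  rtr (fmx (f k) A) @[k --> \oo] --> rtr (fmx f' A).
Proof.
move=> ff; apply: (cvg_ext (fun k => rtr_fmx (f k) A) (rtr_fmx f' A)).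
exact: cvg_fsum.
Qed.

(** Bounds the maximal absolute row sum, the operator norm for the supremum norm on column vectors;
    hence subadditive and submultiplicative. *)
Definition row_bound m n (A : 'M[C]_(m, n)) (c : R) :=
  forall i, \sum_j normc (A i j) <= c.

Lemma normc_ge0 (z : C) : 0 <= normc z.
Proof. by case: z => a b; exact: sqrtr_ge0. Qed.

Lemma normc_sum (I : Type) (r : seq I) (Q : pred I) (F : I -> C) :
  normc (\sum_(i <- r | Q i) F i) <= \sum_(i <- r | Q i) normc (F i).
Proof.
elim/big_rec2: _ => [|i y1 y2 _ IH]; first by rewrite normc0.
by apply: le_trans (le_normcD _ _) _; rewrite lerD2l.
Qed.

Lemma Re_le_normc (z : C) : `|complex.Re z| <= normc z.
Proof.
case: z => a b /=; rewrite -sqrtr_sqr ler_wsqrtr // lerDl; exact: sqr_ge0.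
Qed.

Lemma Im_le_normc (z : C) : `|complex.Im z| <= normc z.
Proof.
case: z => a b /=; rewrite -sqrtr_sqr ler_wsqrtr // lerDr; exact: sqr_ge0.
Qed.

Lemma row_boundD m n (A B : 'M[C]_(m, n)) a b :
  row_bound A a -> row_bound B b -> row_bound (A + B) (a + b).
Proof.
move=> Aa Bb i; apply: le_trans (lerD (Aa i) (Bb i)); rewrite -big_split /=.
by apply: ler_sum => j _; rewrite mxE le_normcD.
Qed.

Lemma row_boundZ m n (A : 'M[C]_(m, n)) a c : 0 <= c ->
  row_bound A a -> row_bound (c%:C *: A) (c * a).
Proof.
move=> c0 Aa i; apply: le_trans (ler_wpM2l c0 (Aa i)); rewrite mulr_sumr.
apply: ler_sum => j _; rewrite mxE normcM ler_wpM2r ?normc_ge0 //=.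
by rewrite expr0n /= addr0 sqrtr_sqr ger0_norm.
Qed.

Lemma row_boundM m n p (A : 'M[C]_(m, n)) (B : 'M[C]_(n, p)) a b :
  0 <= b -> row_bound A a -> row_bound B b -> row_bound (A *m B) (a * b).
Proof.
move=> b0 Aa Bb i; apply: le_trans (ler_wpM2r b0 (Aa i)).
rewrite mulr_suml; under eq_bigr do rewrite mxE.
apply: (@le_trans _ _ (\sum_j \sum_k normc (A i k) * normc (B k j))).
  apply: ler_sum => j _; apply: le_trans (normc_sum _ _ _) _.
  by apply: ler_sum => k _; rewrite normcM.
rewrite exchange_big /=; apply: ler_sum => k _.
by rewrite -mulr_sumr ler_wpM2l ?normc_ge0.
Qed.

Lemma row_bound1 n : row_bound (1%:M : 'M[C]_n) 1.
Proof.
move=> i; rewrite (bigD1 i) //= big1 => [|j ji].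
  by rewrite mxE eqxx addr0 normc1.
by rewrite mxE eq_sym (negbTE ji) normc0.
Qed.

Lemma row_boundX n (A : 'M[C]_n) a k : 0 <= a -> row_bound A a ->
  row_bound (A ^+ k) (a ^+ k).
Proof.
move=> a0 Aa; elim: k => [|k IH]; first exact: row_bound1.
by rewrite !exprSr; apply: row_boundM.
Qed.

Lemma row_bound_ex m n (A : 'M[C]_(m, n)) : exists2 a, 0 <= a & row_bound A a.
Proof.
have N0 i : 0 <= \sum_j normc (A i j).
  by apply: sumr_ge0 => j _; exact: normc_ge0.
exists (\sum_i \sum_j normc (A i j)); first exact: sumr_ge0.
by move=> i; rewrite (bigD1 i) //= lerDl sumr_ge0.
Qed.

Lemma row_bound_rtr n (A : 'M[C]_n) c : row_bound A c -> `|rtr A| <= n%:R * c.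
Proof.
move=> Ac; rewrite /rtr /mxtrace Re_sum.
apply: le_trans (ler_norm_sum _ _ _) _.
rewrite -[n in n%:R]card_ord mulr_natl -sumr_const.
apply: ler_sum => i _; apply: le_trans (Re_le_normc _) _.
apply: le_trans (Ac i); rewrite (bigD1 i) //= lerDl sumr_ge0 // => j _.
exact: normc_ge0.
Qed.

(** Telescoping: each step splits off [Z ^+ k *m (Z - X)]. The hypothesis [1 <= z] permits the
    factor [z ^+ k] in place of [z ^+ k.-1], which makes the induction uniform from [k = 0]. *)
Lemma row_bound_subX n (X Z : 'M[C]_n) z e k : 1 <= z -> 0 <= e ->
  row_bound X z -> row_bound Z z -> row_bound (Z - X) e ->
  row_bound (Z ^+ k - X ^+ k) (k%:R * z ^+ k * e).
Proof.
move=> z1 e0 Xz Zz ZX; have z0 : 0 <= z by apply: le_trans z1.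
elim: k => [|k IH].
  rewrite !expr0 subrr !mul0r => i; rewrite big1 // => j _.
  by rewrite mxE normc0.
have -> : Z ^+ k.+1 - X ^+ k.+1 = Z ^+ k *m (Z - X) + (Z ^+ k - X ^+ k) *m X.
  by rewrite mulmxBr mulmxBl addrA subrK !mulmxE -!exprSr.
move=> i; apply: le_trans (row_boundD (row_boundM e0 (row_boundX k z0 Zz) ZX)
  (row_boundM z0 IH Xz) i) _.
rewrite exprSr -natr1 -subr_ge0.
have -> : (k%:R + 1) * (z ^+ k * z) * e - (z ^+ k * e + k%:R * z ^+ k * e * z) =
  z ^+ k * e * (z - 1) by ring.
by rewrite !mulr_ge0 ?exprn_ge0 // subr_ge0.
Qed.

Lemma row_bound_le m n (A : 'M[C]_(m, n)) a b :
  a <= b -> row_bound A a -> row_bound A b.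
Proof. by move=> ab Aa i; apply: le_trans (Aa i) ab. Qed.

(** The bridge from functional calculus to matrix algebra: the right side no longer mentions a
    diagonalisation of [A]. *)
Lemma euler_fmx k n (A : 'M[C]_n) : herm A ->
  fmx (euler k) A = (1%:M + ((2 ^ k)%:R^-1)%:C *: A) ^+ (2 ^ k).
Proof.
move=> hA; rewrite -{2}(fmx_id hA) fmxZ -[in RHS](fmx1 A) fmxD fmxX.
by apply: fmx_ext => i; rewrite /euler mulrC.
Qed.

(* rtr_pow2 at P = 1 + A / 2^k and Q = 1 + B / 2^k, as k tends to infinity: on
   the left (P Q)^(2^k) may be replaced by (1 + (A + B) / 2^k)^(2^k). *)
Theorem golden_thompson n (A B : 'M[C]_n) : herm A -> herm B ->
  rtr (fmx expR (A + B)) <= rtr (fmx expR A *m fmx expR B).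
Proof.
move=> hA hB.
have [a a0 Aa] := row_bound_ex A; have [b b0 Bb] := row_bound_ex B.
(* [K / N] with [N = 2^k] bounds the change of trace: [n] comes from the trace, [N z^N h^2 a b] from
   [row_bound_subX] with [Z - X = h^2 A B], and [z = expR (h (a + b))], [h = 1 / N] turn the latter
   into [expR (a + b) a b / N]. *)
pose K := n%:R * (expR (a + b) * (a * b)).
have cvgl : rtr (fmx (euler k) (A + B)) - K / (2 ^ k)%:R @[k --> \oo] -->
    rtr (fmx expR (A + B)).
  apply: (cvg_ext (fun=> erefl) (esym (subr0 _))).
  by apply: cvgB; [apply: cvg_rtr_fmx; exact: cvg_euler|exact: cvg_div_pow2].
have cvgr := cvg_rtr_fmx_fmx (A := A) (B := B) (@cvg_euler R) (@cvg_euler R).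
apply: (ler_cvg_to cvgl cvgr).
near=> k.
have N0 : 0 < (2 ^ k)%:R :> R by rewrite ltr0n expn_gt0.
set h : R := (2 ^ k)%:R^-1; have h0 : 0 <= h by rewrite invr_ge0 ltW.
set P := 1%:M + h%:C *: A; set Q := 1%:M + h%:C *: B.
have hP : herm P by apply: hermD; [exact: herm1|exact: hermZ].
have hQ : herm Q by apply: hermD; [exact: herm1|exact: hermZ].
have := (rtr_pow2 R n k).2 _ _ hP hQ.
rewrite -!euler_fmx // => /(le_trans _); apply.
rewrite euler_fmx; last exact: hermD.
set X := 1%:M + _; set Z := P *m Q.
pose z := expR (h * (a + b)).
have z1 : 1 <= z by rewrite /z -expR0 ler_expR mulr_ge0 // addr_ge0.
have E : Z - X = (h ^+ 2)%:C *: (A *m B).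
  rewrite /Z /X /P /Q mulmxDl !mulmxDr !mul1mx !mulmx1 -scalemxAl -scalemxAr.
  rewrite scalerA -rmorphM -expr2 scalerDr.
  rewrite !addrA opprD opprD !addrA.
  by apply/matrixP => i j; rewrite !mxE; ring.
have Xz : row_bound X z.
  apply: row_bound_le (expR_ge1Dx _) _.
  apply: row_boundD (@row_bound1 n) _.
  by apply: row_boundZ => //; exact: row_boundD.
have Zz : row_bound Z z.
  rewrite /z mulrDr expRD.
  apply: row_bound_le _ (row_boundM _
    (row_boundD (@row_bound1 n) (row_boundZ h0 Aa))
    (row_boundD (@row_bound1 n) (row_boundZ h0 Bb))).
    by rewrite ler_pM ?expR_ge1Dx // addr_ge0 // mulr_ge0.
  by rewrite addr_ge0 // mulr_ge0.
have ZX : row_bound (Z - X) (h ^+ 2 * (a * b)).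
  by rewrite E; apply: row_boundZ; [exact: sqr_ge0|exact: row_boundM].
have hab0 : 0 <= h ^+ 2 * (a * b) by rewrite !mulr_ge0.
have := row_bound_rtr (row_bound_subX (2 ^ k) z1 hab0 Xz Zz ZX).
rewrite rtrB ler_distl => /andP[H _].
apply: le_trans H; rewrite lerD2l lerN2.
rewrite le_eqVlt; apply/orP; left; apply/eqP.
have Nh : (2 ^ k)%:R * h = 1 by rewrite divff ?gt_eqF.
rewrite /K /z -expRM_natl (mulrA _ h) Nh mul1r -/h.
rewrite -[RHS]mulr1 -[X in _ = _ * X]Nh.
ring.
Unshelve. all: by end_near. Qed.

(* Klein's inequality for the exponential. *)
Lemma klein_expR n (K M : 'M[C]_n) : herm K -> herm M ->
  rtr (fmx expR K) + rtr (fmx expR K *m M) <= rtr (fmx expR (K + M)).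
Proof.
move=> hK hM; set A := K + M; have hA : herm A by exact: hermD.
have -> : M = A - K by rewrite /A addrC addKr.
(* Every trace is put in the form of [rtr_fmx_fmx] for the pair [A], [K], the constant function 1
   filling a missing factor. What remains for each pair of eigenvalues is
   [expR x >= expR y * (1 + (x - y))]. *)
have E1 : rtr (fmx expR K *m A) = rtr (fmx id A *m fmx expR K).
  by rewrite [in RHS](fmx_id hA) rtrC.
have E2 : rtr (fmx expR K *m K) =
    rtr (fmx (fun=> 1) A *m fmx (fun x => expR x * x) K).
  by rewrite fmx1 mul1mx -fmxM fmx_id.
have E3 : rtr (fmx expR K) = rtr (fmx (fun=> 1) A *m fmx expR K).
  by rewrite fmx1 mul1mx.
have E4 : rtr (fmx expR A) = rtr (fmx expR A *m fmx (fun=> 1) K).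
  by rewrite fmx1 mulmx1.
rewrite rtr_fmx_fmx in E1; rewrite rtr_fmx_fmx in E2.
rewrite rtr_fmx_fmx in E3; rewrite rtr_fmx_fmx in E4.
rewrite mulmxBr rtrB -subr_ge0.
rewrite -(congr2 (fun x y => x - y) (esym E4)
  (congr2 +%R (esym E3) (congr2 (fun x y => x - y) (esym E1) (esym E2)))).
rewrite -!(sumrB, big_split) /=; apply: sumr_ge0 => i _.
rewrite -!(sumrB, big_split) /=; apply: sumr_ge0 => j _.
set x := eig A i; set y := eig K j.
have -> : expR x * 1 * overlap A K i j - (1 * expR y * overlap A K i j +
   (x * expR y * overlap A K i j - 1 * (expR y * y) * overlap A K i j)) =
   (expR x - expR y * (1 + (x - y))) * overlap A K i j by ring.
rewrite mulr_ge0 ?overlap_ge0 // subr_ge0.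
have -> : expR x = expR y * expR (x - y) by rewrite -expRD addrC subrK.
by rewrite ler_wpM2l ?expR_ge0 ?expR_ge1Dx.
Qed.
End TraceInequalities.

(** * Eigenvalues *)

Section Eigenvalues.
Variable R : realType.
Local Notation C := R[i].

Lemma prod_XsubC_perm (F : fieldType) (r s : seq F) :
  \prod_(z <- r) ('X - z%:P) = \prod_(z <- s) ('X - z%:P) -> perm_eq r s.
Proof.
elim: r s => [|x r IH] s E.
  case: s E => [|y s] // /(congr1 (fun p : {poly F} => size p)).
  by rewrite !size_prod_XsubC.
have xs : x \in s by rewrite -root_prod_XsubC -E root_prod_XsubC mem_head.
rewrite perm_sym (perm_trans (perm_to_rem xs)) // perm_cons perm_sym.
apply: IH; have X0 : 'X - x%:P != 0 :> {poly F} by rewrite polyXsubC_eq0.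
apply: (mulfI X0); move: E.
by rewrite big_cons (perm_big _ (perm_to_rem xs)) big_cons.
Qed.

Lemma char_poly_herm n (A : 'M[C]_n) : herm A ->
  char_poly A = \prod_i ('X - ((eig A i)%:C)%:P).
Proof.
move=> hA; set P := spectralmx A.
pose D : 'M[C]_n := diag_mx (\row_i (eig A i)%:C).
have AE : A = P^t* *m D *m P by rewrite -[LHS](fmx_id hA).
have PP : \det (map_mx polyC (P^t*)) * \det (map_mx polyC P) = 1.
  by rewrite -det_mulmx -map_mxM spectral_mulJl map_mx1 det1.
have E : char_poly_mx A =
    map_mx polyC (P^t*) *m char_poly_mx D *m map_mx polyC P.
  rewrite /char_poly_mx mulmxBr mulmxBl -!map_mxM -AE; congr (_ - _).
  by rewrite mul_mx_scalar -scalemxAl -map_mxM spectral_mulJl map_mx1 scalemx1.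
rewrite /char_poly E !det_mulmx mulrAC PP mul1r.
rewrite -/(char_poly D) char_poly_trig ?diag_mx_is_trig //.
by apply: eq_bigr => i _; rewrite !mxE eqxx.
Qed.

Lemma eigenvalues_perm n (A : 'M[C]_n) : herm A ->
  perm_eq (eigenvalues A) [seq eig A i | i <- enum 'I_n].
Proof.
move=> hA; rewrite /eigenvalues perm_sort.
case: closed_field_poly_normal => r /=.
rewrite (monicP (char_poly_monic A)) scale1r char_poly_herm // => E.
have -> : [seq eig A i | i <- enum 'I_n] =
    [seq complex.Re z | z <- [seq (eig A i)%:C | i <- enum 'I_n]].
  by rewrite -map_comp; apply: eq_map.
apply/perm_map/prod_XsubC_perm; rewrite -E big_map.
by rewrite big_enum.
Qed.

(** In a decreasing list the entries at least [t] form a prefix. *)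
Lemma sorted_nth_ge (s : seq R) k t :
  sorted (fun x y => y <= x) s -> (k < size s)%N ->
  (t <= s`_k) = (k < count (fun x => t <= x)%R s)%N.
Proof.
elim: s k => [|x s IH] k //= xs.
have le_x : {in s, forall y, y <= x}.
  apply/allP; apply: order_path_min xs => y1 y2 y3 h1 h2; exact: le_trans h2 h1.
have [tx|xt] := leP t x.
  by case: k => [|k] // ks; rewrite IH // (path_sorted xs).
have -> : count (fun x => t <= x) s = 0%N.
  apply/eqP; rewrite -leqn0 leqNgt -has_count; apply/hasPn => y ys.
  by rewrite -ltNge (le_lt_trans (le_x y ys)).
case: k => [|k] ks; first by rewrite leNgt xt.
by apply/negbTE; rewrite -ltNge (le_lt_trans (le_x _ (mem_nth _ ks))).
Qed.

(** A count ignores order: the sorted position [k] is traded for a sum over the unsorted [eig A i],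
    the form used for Courant-Fischer and for measurability. *)
Lemma le_lambda n (A : 'M[C]_n) k t : herm A -> (1 <= k <= n)%N ->
  (t <= lambda k A) = (k <= \sum_(i < n) (t <= eig A i)%R)%N.
Proof.
move=> hA /andP[k1 kn]; rewrite /lambda sorted_nth_ge; first last.
- rewrite (perm_size (eigenvalues_perm hA)) size_map size_enum_ord.
  by rewrite prednK.
- by apply: sort_sorted => x y; exact: ge_total.
rewrite prednK // (permP (eigenvalues_perm hA)) count_map -sum1_count.
by rewrite big_mkcond big_enum.
Qed.

Lemma eig_le_lambda_max n (A : 'M[C]_n) i : herm A -> eig A i <= lambda_max A.
Proof.
case: n => [|n] in A i *; first by case: i.
by move=> hA; rewrite le_lambda // (bigD1 i) //= lexx.
Qed.

Lemma lambda_max_eig n (A : 'M[C]_n) : (0 < n)%N -> herm A ->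
  exists i, lambda_max A <= eig A i.
Proof.
move=> n0 hA; apply/existsP; rewrite -[X in is_true X]negbK negb_exists.
apply/negP => /forallP H.
have := lexx (lambda 1 A); rewrite le_lambda ?n0 //.
by rewrite big1 // => i _; rewrite (negbTE (H i)).
Qed.

Definition sqn (z : C) : R := complex.Re (z * z^*).

Lemma sqn_ge0 z : 0 <= sqn z.
Proof. by rewrite /sqn Re_mulJ addr_ge0 ?sqr_ge0. Qed.

Lemma quad_fmx f n (A : 'M[C]_n) (x : 'rV[C]_n) :
  complex.Re ((x *m fmx f A *m x^t*) 0 0) =
  \sum_i f (eig A i) * sqn ((x *m (spectralmx A)^t*) 0 i).
Proof.
rewrite /fmx /spectral_diagmx; set Q := spectralmx A.
have -> : x *m (Q^t* *m diag_mx (\row_i (f (eig A i))%:C) *m Q) *m x^t* =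
    ((x *m Q^t*) *m diag_mx (\row_i (f (eig A i))%:C)) *m (x *m Q^t*)^t*.
  by rewrite trmxCM trmxCK !mulmxA.
rewrite mul_mx_diag mxE Re_sum; apply: eq_bigr => j _.
rewrite /sqn -ReZ; congr (complex.Re _).
rewrite [(\matrix_(_, _) _) _ _]mxE [(\row__ _) _ _]mxE.
rewrite [((x *m Q^t*)^t*) _ _]mxE [((x *m Q^t*)^T) _ _]mxE.
by rewrite mulrAC mulrC.
Qed.

Lemma normsq_fmx n (A : 'M[C]_n) (x : 'rV[C]_n) :
  complex.Re ((x *m x^t*) 0 0) = \sum_i sqn ((x *m (spectralmx A)^t*) 0 i).
Proof.
have := quad_fmx (fun=> 1) A x; rewrite fmx1 mulmx1 => ->.
by apply: eq_bigr => i _; rewrite mul1r.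
Qed.

Lemma normsq_gt0 n (x : 'rV[C]_n) : x != 0 -> 0 < complex.Re ((x *m x^t*) 0 0).
Proof.
move=> x0.
have S0 i : 0 <= complex.Re (x 0 i * (x^t*) i 0).
  by rewrite !mxE; exact: sqn_ge0.
rewrite mxE Re_sum lt_neqAle sumr_ge0 // andbT eq_sym psumr_neq0 //.
have [i xi] : exists i, x 0 i != 0.
  by apply/rV0Pn.
apply/hasP; exists i; rewrite ?mem_index_enum //= lt_neqAle S0 andbT !mxE.
rewrite Re_mulJ eq_sym paddr_eq0 ?sqr_ge0 // !sqrf_eq0.
by apply: contra xi => /andP[/eqP a /eqP b]; rewrite eq_complex a b !eqxx.
Qed.

Lemma quad_le_lambda_max n (A : 'M[C]_n) (x : 'rV[C]_n) : herm A ->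
  complex.Re ((x *m A *m x^t*) 0 0) <=
  lambda_max A * complex.Re ((x *m x^t*) 0 0).
Proof.
move=> hA; rewrite -{1}(fmx_id hA) quad_fmx (normsq_fmx A) mulr_sumr.
by apply: ler_sum => i _; rewrite ler_wpM2r ?sqn_ge0 ?eig_le_lambda_max.
Qed.

(* The range of V has dimension n - k + 1, so it meets the span of the
   eigenvectors for the k largest eigenvalues. *)
Lemma courant_fischer_le n k (A : 'M[C]_n) (V : 'M[C]_(n, n - k + 1)) :
  herm A -> (1 <= k <= n)%N -> stiefel V ->
  lambda k A <= lambda_max (V^t* *m A *m V).
Proof.
move=> hA kn VV; set t := lambda k A.
pose J : {set 'I_n} := [set i | t <= eig A i]%SET.
have cJ : (k <= #|J|)%N.
  have := lexx t; rewrite {2}/t le_lambda // => /leq_trans; apply.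
  rewrite cardsE -sum1_card [leqRHS]big_mkcond; apply: leq_sum => i _.
  have -> : (i \in (fun x => t <= eig A x)%R) = (t <= eig A i)%R by [].
  by case: (t <= _)%R.
set Q := spectralmx A.
(* A row [y] killed by [M] yields [x = y *m V^t*] orthogonal to every eigenvector with eigenvalue
   below [t]. A nonzero such [y] exists, since [M] has [n - k + 1] rows and at most [n - k]
   columns. *)
pose M : 'M[C]_(n - k + 1, #|(~: J)%SET|) :=
  \matrix_(a, b) (V^t* *m Q^t*) a (enum_val b).
have rM : (\rank M < n - k + 1)%N.
  apply: leq_ltn_trans (rank_leq_col M) _.
  by rewrite addn1 ltnS cardsCs finset.setCK card_ord leq_sub2l.
have : kermx M != 0 by rewrite -mxrank_eq0 mxrank_ker -lt0n subn_gt0.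
case/rowV0Pn => y /sub_kermxP yM y0.
pose x := y *m V^t*; pose z := x *m Q^t*.
have z0 i : ~~ (t <= eig A i) -> z 0 i = 0.
  move=> iJ; have iJ' : i \in (~: J)%SET by rewrite !inE.
  have := congr1 (fun B : 'rV[C]_ _ => B 0 (enum_rank_in iJ' i)) yM.
  rewrite /= [LHS]mxE [RHS]mxE => <-.
  rewrite /z /x -mulmxA mxE; apply: eq_bigr => j _.
  by rewrite [in RHS]mxE enum_rankK_in.
have xx : x *m x^t* = y *m y^t*.
  by rewrite /x trmxCM trmxCK mulmxA -(mulmxA y) VV mulmx1.
have y1 := normsq_gt0 y0.
rewrite -(ler_pM2r y1).
apply: le_trans (quad_le_lambda_max _ (herm_conj _ hA)).
have -> : y *m (V^t* *m A *m V) *m y^t* = x *m A *m x^t*.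
  by rewrite /x trmxCM trmxCK !mulmxA.
rewrite -[X in _ *m X *m _](fmx_id hA) quad_fmx -xx (normsq_fmx A) mulr_sumr.
apply: ler_sum => i _; have [ti|ti] := boolP (t <= eig A i).
  by rewrite ler_wpM2r ?sqn_ge0.
by rewrite -/Q -/z z0 // /sqn mul0r !mulr0.
Qed.

Lemma expR_lambda_max_le n (A : 'M[C]_n) (th : R) : (0 < n)%N -> 0 <= th ->
  herm A -> expR (th * lambda_max A) <= rtr (fmx (fun x => expR (th * x)) A).
Proof.
move=> n0 th0 hA; have [i li] := lambda_max_eig n0 hA.
rewrite rtr_fmx (bigD1 i) //=.
apply: le_trans (_ : expR (th * eig A i) <= _).
  by rewrite ler_expR ler_wpM2l.
by rewrite lerDl sumr_ge0 // => j _; exact: expR_ge0.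
Qed.

Lemma rtr_expR_le n (A : 'M[C]_n) (th : R) : 0 <= th -> herm A ->
  rtr (fmx (fun x => expR (th * x)) A) <= n%:R * expR (th * lambda_max A).
Proof.
move=> th0 hA; rewrite rtr_fmx -[n in n%:R]card_ord mulr_natl -sumr_const.
by apply: ler_sum => i _; rewrite ler_expR ler_wpM2l // eig_le_lambda_max.
Qed.

Lemma cvg_fmx (f : nat -> R -> R) (f' : R -> R) n (A : 'M[C]_n) a b :
  (forall x, f k x @[k --> \oo] --> f' x) ->
  complex.Re (fmx (f k) A a b) @[k --> \oo] --> complex.Re (fmx f' A a b) /\
  complex.Im (fmx (f k) A a b) @[k --> \oo] --> complex.Im (fmx f' A a b).
Proof.
pose w i : C := ((spectralmx A i a)^* * spectralmx A i b)%R.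
have ReE g : complex.Re (fmx g A a b) = \sum_i g (eig A i) * complex.Re (w i).
  by rewrite fmxE Re_sum; apply: eq_bigr => i _; rewrite ReZ.
have ImE g : complex.Im (fmx g A a b) = \sum_i g (eig A i) * complex.Im (w i).
  by rewrite fmxE Im_sum; apply: eq_bigr => i _; rewrite ImZ.
move=> ff; split.
  apply: (cvg_ext (fun k => ReE (f k)) (ReE f')).
  by apply: cvg_fsum => i; apply: cvgM => //; exact: cvg_cst.
apply: (cvg_ext (fun k => ImE (f k)) (ImE f')).
by apply: cvg_fsum => i; apply: cvgM => //; exact: cvg_cst.
Qed.

(** [fmx g A] carries a diagonalisation of its own, unrelated to that of [A], so the eigenvalue sums
    cannot be matched term by term. For each [k] the polynomial [euler k] gives the same matrix on
    both sides, and entrywise limits are unique. *)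
Lemma fmx_expR_comp g n (A : 'M[C]_n) :
  fmx expR (fmx g A) = fmx (fun x => expR (g x)) A.
Proof.
have E k : fmx (euler k) (fmx g A) = fmx (fun x => euler k (g x)) A.
  rewrite euler_fmx; last exact: fmx_herm.
  rewrite fmxZ -(fmx1 A) fmxD fmxX; apply: fmx_ext => i.
  by rewrite /euler mulrC.
apply/matrixP => a b.
have [R1 I1] := cvg_fmx (fmx g A) a b (@cvg_euler R).
have [R2 I2] := cvg_fmx (f := fun k x => euler k (g x))
  (f' := fun x => expR (g x)) A a b (fun x => @cvg_euler R (g x)).
apply/eqP; rewrite eq_complex; apply/andP; split; apply/eqP.
  apply: (cvg_unique _ R1); first exact: Rhausdorff.
  exact: (cvg_ext
  (fun k => congr1 (fun B : 'M[C]_n => complex.Re (B a b)) (E k)) erefl R2).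
apply: (cvg_unique _ I1); first exact: Rhausdorff.
exact: (cvg_ext
  (fun k => congr1 (fun B : 'M[C]_n => complex.Im (B a b)) (E k)) erefl I2).
Qed.

Lemma fmx_expRZ n (A : 'M[C]_n) (th : R) : herm A ->
  fmx expR (th%:C *: A) = fmx (fun x => expR (th * x)) A.
Proof. by move=> hA; rewrite -{1}(fmx_id hA) fmxZ fmx_expR_comp. Qed.

Lemma normc_sqn (z : C) : Normc.normc z = Num.sqrt (sqn z).
Proof. by rewrite /sqn Re_mulJ; case: z. Qed.

Lemma normc_spectralmx_le1 n (A : 'M[C]_n) i j :
  Normc.normc (spectralmx A i j) <= 1.
Proof.
rewrite normc_sqn -sqrtr1 ler_wsqrtr //.
have : complex.Re ((spectralmx A *m (spectralmx A)^t*) i i) = 1.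
  by rewrite spectral_mulJ mxE eqxx.
rewrite mxE Re_sum => <-; rewrite (bigD1 j) //= !mxE lerDl.
rewrite sumr_ge0 // => k _; rewrite !mxE.
exact: sqn_ge0.
Qed.

Lemma normc_conj (z : C) : Normc.normc (z^*)%R = Normc.normc z.
Proof. by rewrite conjE; case: z => a b /=; rewrite sqrrN. Qed.

(** The eigenvalues of the exponential are positive and a unitary matrix has entries of modulus at
    most 1. The trace thus dominates each entry for integrability. *)
Lemma normc_fmx_expR_le n (A : 'M[C]_n) a b :
  Normc.normc (fmx expR A a b) <= rtr (fmx expR A).
Proof.
rewrite fmxE rtr_fmx; apply: le_trans (normc_sum _ _ _) _.
apply: ler_sum => i _; rewrite Normc.normcM.
have -> : Normc.normc (expR (eig A i))%:C = expR (eig A i).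
  by rewrite /= expr0n /= addr0 sqrtr_sqr ger0_norm ?expR_ge0.
rewrite -[leRHS]mulr1 ler_wpM2l ?expR_ge0 // Normc.normcM normc_conj.
by rewrite mulr_ile1 ?normc_ge0 ?normc_spectralmx_le1.
Qed.
End Eigenvalues.

(** * Expectation and independence *)

Section RealExpectation.
Context d (T : measurableType d) (R : realType) (P : probability T R).
Implicit Types f g h : T -> R.

Definition rint f := P.-integrable setT (fun w => (f w)%:E).
Definition rexp f : R := fine ('E_P[f]).

Lemma rexpE f : rint f -> (\int[P]_w (f w)%:E = (rexp f)%:E)%E.
Proof.
by move=> fi; rewrite /rexp unlock fineK //; exact: integrable_fin_num.
Qed.

Lemma rint_meas f : rint f -> measurable_fun setT f.
Proof. by move=> /measurable_int /measurable_EFinP. Qed.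

Lemma rint_cst (c : R) : rint (fun=> c).
Proof. exact: finite_measure_integrable_cst. Qed.

Lemma rexp_cst (c : R) : rexp (fun=> c) = c.
Proof. by rewrite /rexp (expectation_cst P c). Qed.

Lemma rintD f g : rint f -> rint g -> rint (fun w => f w + g w).
Proof. by move=> fi gi; exact: (integrableD measurableT fi gi). Qed.

Lemma rexpD f g :
  rint f -> rint g -> rexp (fun w => f w + g w) = rexp f + rexp g.
Proof.
move=> fi gi; apply: EFin_inj; rewrite EFinD -!rexpE //; last exact: rintD.
exact: (integralD measurableT fi gi).
Qed.

Lemma rintZ (c : R) f : rint f -> rint (fun w => c * f w).
Proof. by move=> fi; exact: (integrableZl measurableT c fi). Qed.

Lemma rexpZ (c : R) f : rint f -> rexp (fun w => c * f w) = c * rexp f.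
Proof.
move=> fi; apply: EFin_inj; rewrite EFinM -!rexpE //; last exact: rintZ.
exact: (integralZl measurableT fi c).
Qed.

Lemma rintN f : rint f -> rint (fun w => - f w).
Proof. by move=> fi; under eq_fun do rewrite -mulN1r; exact: rintZ. Qed.

Lemma rexpN f : rint f -> rexp (fun w => - f w) = - rexp f.
Proof.
by move=> fi; under [in LHS]eq_fun do rewrite -mulN1r; rewrite rexpZ // mulN1r.
Qed.

Lemma rint_le f g : measurable_fun setT f -> (forall w, `|f w| <= g w) ->
  rint g -> rint f.
Proof.
move=> mf fg gi; apply: (le_integrable measurableT _ _ gi).
  exact/measurable_EFinP.
by move=> w _ /=; rewrite lee_fin (le_trans (fg w)) // ler_norm.
Qed.

(* Under the product rule the joint law of f and h is the product of the two
   laws, so that Fubini applies. *)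
Lemma rexpM_indep f h : rint f -> rint h ->
  (forall A B : set R, measurable A -> measurable B ->
    P (f @^-1` A `&` h @^-1` B) = (P (f @^-1` A) * P (h @^-1` B))%E) ->
  rint (fun w => f w * h w) /\ rexp (fun w => f w * h w) = rexp f * rexp h.
Proof.
move=> fi hi PM; have mf := rint_meas fi; have mh := rint_meas hi.
pose F : {mfun T >-> R} := HB.pack f (isMeasurableFun.Build _ _ _ _ _ mf).
pose H : {mfun T >-> R} := HB.pack h (isMeasurableFun.Build _ _ _ _ _ mh).
pose mF := distribution P F; pose mH := distribution P H.
have mphi : measurable_fun setT (fun w => (f w, h w)).
  exact: measurable_fun_pair.
pose phi : {mfun T >-> (R * R)%type} :=
  HB.pack (fun w => (f w, h w)) (isMeasurableFun.Build _ _ _ _ _ mphi).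
pose m' := distribution P phi.
pose k (z : R * R) : \bar R := (z.1 * z.2)%:E.
have mk : measurable_fun setT k.
  by apply/measurable_EFinP; apply: measurable_funM; exact: measurable_funTS.
(* The product rule is given on rectangles; uniqueness of the product measure extends it to all
   measurable subsets of the plane. *)
have E X : measurable X -> (mF \x mH)%E X = m' X.
  by apply: product_measure_unique => A B mA mB; rewrite -PM.
have abs_lty (G : {mfun T >-> R}) : rint G ->
    (\int[distribution P G]_y `|y|%:E < +oo)%E.
  move=> /integrableP[_]; rewrite ge0_integral_distribution //.
  by apply/measurable_EFinP; exact: normr_measurable.
have id_int (G : {mfun T >-> R}) : rint G ->
    (distribution P G).-integrable setT (fun y => y%:E).
  move=> Gi; apply/integrableP; split; first exact/measurable_EFinP.
  exact: abs_lty.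
have mabs : measurable_fun setT (fun y : R => `|y|%:E).
  by apply/measurable_EFinP; exact: normr_measurable.
have ki : (mF \x mH)%E.-integrable setT k.
  apply/integrable12ltyP => //.
  under eq_integral => x _.
    under eq_integral => y _ do rewrite /k /= normrM EFinM.
    rewrite ge0_integralZl //.
    over.
  rewrite /= ge0_integralZr //; last exact: integral_ge0.
  by rewrite lte_mul_pinfty ?integral_ge0 // ?abs_lty //
    ge0_fin_numE ?integral_ge0 // abs_lty.
have m'i : m'.-integrable setT k.
  apply/integrableP; split => //.
  rewrite -(@eq_measure_integral _ _ _ _ _ (mF \x mH)%E); last first.
    by move=> A mA _; exact: E.
  by case/integrableP: ki.
have fhi : rint (fun w => f w * h w).
  move/integrableP: m'i => [_ kl]; apply/integrableP; split.
    by apply/measurable_EFinP; exact: measurable_funM.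
  move: kl; rewrite ge0_integral_distribution //.
  exact: measurableT_comp.
split=> //; apply: EFin_inj.
rewrite -rexpE // EFinM.
transitivity (\int[m']_z k z)%E; first by rewrite integral_distribution.
rewrite -(@eq_measure_integral _ _ _ _ _ (mF \x mH)%E); last first.
  by move=> A mA _; exact: E.
rewrite -integral12_prod_meas1 //.
have IF : (\int[mF]_x x%:E = (rexp f)%:E)%E.
  by rewrite integral_distribution // rexpE.
have IH : (\int[mH]_x x%:E = (rexp h)%:E)%E.
  by rewrite integral_distribution // rexpE.
under eq_integral => x _.
  rewrite /fubini_F /k /=.
  under eq_integral => y _ do rewrite EFinM.
  rewrite integralZl ?id_int // IH.
  over.
by rewrite /= integralZr ?id_int // IF.
Qed.
End RealExpectation.

(** * Measurability of matrix exponentials and of eigenvalue events *)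

Section Measurability.
Variable R : realType.
Local Notation C := R[i].

(** The sigma-algebra of [T] is a parameter: on [gen_by J], the predicate expresses that [X] depends
    only on the matrices indexed by [J]. *)
Definition mx_meas d (T : measurableType d) m n (X : T -> 'M[C]_(m, n)) :=
  forall a b, measurable_fun setT (fun w => complex.Re (X w a b)) /\
              measurable_fun setT (fun w => complex.Im (X w a b)).

Section Closure.
Context d (T : measurableType d).

Lemma mx_meas_cst m n (A : 'M[C]_(m, n)) : mx_meas (fun _ : T => A).
Proof. by move=> a b; split; exact: measurable_cst. Qed.

Lemma mx_measD m n (X Y : T -> 'M[C]_(m, n)) :
  mx_meas X -> mx_meas Y -> mx_meas (fun w => X w + Y w).
Proof.
move=> mX mY a b; split.
  under eq_fun do rewrite mxE ReD.
  by apply: measurable_funD; [case: (mX a b)|case: (mY a b)].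
under eq_fun do rewrite mxE ImD.
by apply: measurable_funD; [case: (mX a b)|case: (mY a b)].
Qed.

Lemma mx_meas_sum (I : Type) (r : seq I) (Q : pred I) m n
    (X : I -> T -> 'M[C]_(m, n)) :
  (forall i, Q i -> mx_meas (X i)) ->
  mx_meas (fun w => \sum_(i <- r | Q i) X i w).
Proof.
move=> mX; elim: r => [|i r IH].
  by under eq_fun do rewrite big_nil; exact: mx_meas_cst.
under eq_fun do rewrite big_cons.
by case: (boolP (Q i)) => // Qi; apply: mx_measD => //; exact: mX.
Qed.

Lemma mx_measM m n p (X : T -> 'M[C]_(m, n)) (Y : T -> 'M[C]_(n, p)) :
  mx_meas X -> mx_meas Y -> mx_meas (fun w => X w *m Y w).
Proof.
move=> mX mY a b; split.
  under eq_fun do rewrite mxE Re_sum; apply: measurable_sum => k /=.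
  under eq_fun do rewrite ReMc.
  have [rX iX] := mX a k; have [rY iY] := mY k b.
  by apply: measurable_funB; exact: measurable_funM.
under eq_fun do rewrite mxE Im_sum; apply: measurable_sum => k /=.
under eq_fun do rewrite ImMc.
have [rX iX] := mX a k; have [rY iY] := mY k b.
by apply: measurable_funD; exact: measurable_funM.
Qed.

Lemma mx_measZ m n (c : R) (X : T -> 'M[C]_(m, n)) :
  mx_meas X -> mx_meas (fun w => c%:C *: X w).
Proof.
move=> mX; under eq_fun do rewrite -mul_scalar_mx.
by apply: mx_measM => //; exact: mx_meas_cst.
Qed.

Lemma mx_measX n (X : T -> 'M[C]_n) k :
  mx_meas X -> mx_meas (fun w => X w ^+ k).
Proof.
move=> mX; elim: k => [|k IH]; first exact: mx_meas_cst.
by under eq_fun do rewrite exprS; exact: mx_measM.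
Qed.

Lemma mx_meas_rtr n (X : T -> 'M[C]_n) :
  mx_meas X -> measurable_fun setT (fun w => rtr (X w)).
Proof.
move=> mX; rewrite /rtr /mxtrace; under eq_fun do rewrite Re_sum.
by apply: measurable_sum => i; case: (mX i i).
Qed.

(** The chosen diagonalisation need not depend measurably on [w]; the polynomials [euler k] of [X w]
    do, and the exponential is their pointwise limit. *)
Lemma mx_meas_expR n (X : T -> 'M[C]_n) : (forall w, herm (X w)) ->
  mx_meas X -> mx_meas (fun w => fmx expR (X w)).
Proof.
move=> hX mX.
have me k : mx_meas (fun w => fmx (euler k) (X w)).
  under eq_fun do rewrite euler_fmx //.
  by apply: mx_measX; apply: mx_measD; [exact: mx_meas_cst|exact: mx_measZ].
move=> a b; split.
  apply: (@measurable_fun_cvg _ _ _ _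
      (fun k w => complex.Re (fmx (euler k) (X w) a b))) => [k|w _].
    by case: (me k a b).
  by case: (cvg_fmx (X w) a b (@cvg_euler R)).
apply: (@measurable_fun_cvg _ _ _ _
    (fun k w => complex.Im (fmx (euler k) (X w) a b))) => [k|w _].
  by case: (me k a b).
by case: (cvg_fmx (X w) a b (@cvg_euler R)).
Qed.

End Closure.

(* The eigenvalues that are at least t are counted by a limit of double
   exponentials, which is measurable. *)
Definition soft_step (t : R) k x :=
  expR (- k.+1%:R^-1 * expR (k.+1%:R * (t - x))).

(** Let [N = k.+1]. For [x >= t] the inner exponential is at most 1, and the factor [1 / N] drives
    the value to 1 even at [x = t]. For [x < t], [expR (N (t - x)) / N] is at least
    [N (t - x)^2 / 2], which sends the value to 0. *)
Lemma cvg_soft_step t x : soft_step t k x @[k --> \oo] --> ((t <= x)%R%:R : R).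
Proof.
have [tx|xt] := leP t x.
  apply: (@squeeze_cvgr _ _ _ _ (fun k => 1 - harmonic k) (fun=> 1)).
  - near=> k; rewrite /soft_step /harmonic /=.
    have k0 : 0 < k.+1%:R^-1 :> R by rewrite invr_gt0.
    have e1 : expR (k.+1%:R * (t - x)) <= 1.
      by rewrite -expR0 ler_expR mulr_ge0_le0 // subr_le0.
    have e0 := expR_gt0 (k.+1%:R * (t - x)).
    move: e1 e0 k0; set e := expR _; set h := _^-1 => e1 e0 k0.
    apply/andP; split; last by rewrite -[leRHS]expR0 ler_expR; nra.
    by apply: le_trans (expR_ge1Dx _); nra.
  - have H : (1 - harmonic k) @[k --> \oo] --> (1 - 0 : R).
      by apply: cvgB; [exact: cvg_cst|exact: cvg_harmonic].
    by rewrite subr0 in H.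
  - exact: cvg_cst.
apply: (@squeeze_cvgr _ _ _ _ (fun=> 0)
  (fun k => 2 / (t - x) ^+ 2 * harmonic k)).
- near=> k; rewrite /soft_step /harmonic /=.
  rewrite expR_ge0 /=; set N : R := k.+1%:R; set c := t - x.
  have c0 : 0 < c by rewrite subr_gt0.
  have N0 : 0 < N by rewrite /N ltr0n.
  set y := N^-1 * expR (N * c).
  have yc : N * c ^+ 2 / 2 <= y.
    rewrite /y ler_pdivlMl //.
    have Nc0 : 0 <= N * c by rewrite mulr_ge0 ?ltW.
    have := expR_taylor2_pos Nc0; rewrite exprMn => H.
    have -> : N * (N * c ^+ 2 / 2) = N ^+ 2 * c ^+ 2 / 2 by ring.
    by apply: (le_trans H); rewrite -addrA -opprD lerBlDr lerDl addr_ge0.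
  have q0 : 0 < N * c ^+ 2 / 2 by rewrite !mulr_gt0 ?exprn_gt0.
  have y0 : 0 < y by apply: lt_le_trans yc.
  rewrite mulNr expRN.
  apply: (@le_trans _ _ y^-1).
    rewrite lef_pV2 ?posrE ?expR_gt0 //.
    by apply: le_trans (expR_ge1Dx y); rewrite lerDr.
  have -> : 2 / c ^+ 2 * N^-1 = (N * c ^+ 2 / 2)^-1.
    by field; rewrite !lt0r_neq0.
  by rewrite lef_pV2 ?posrE.
- exact: cvg_cst.
have H : (2 / (t - x) ^+ 2 * harmonic k) @[k --> \oo] -->
    (2 / (t - x) ^+ 2 * 0 : R).
  by apply: cvgM; [exact: cvg_cst|exact: cvg_harmonic].
by rewrite mulr0 in H.
Unshelve. all: by end_near. Qed.

Lemma soft_step_fmx t k n (A : 'M[C]_n) : herm A ->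
  fmx (soft_step t k) A =
  fmx expR ((- k.+1%:R^-1)%:C *:
    fmx expR ((- k.+1%:R)%:C *: A + (k.+1%:R * t)%:C *: 1%:M)).
Proof.
move=> hA.
have -> : (- k.+1%:R)%:C *: A + (k.+1%:R * t)%:C *: 1%:M =
    fmx (fun x => k.+1%:R * (t - x)) A.
  rewrite -{1}(fmx_id hA) -(fmx1 A) !fmxZ fmxD; apply: fmx_ext => i.
  by rewrite /=; ring.
by rewrite fmx_expR_comp fmxZ fmx_expR_comp.
Qed.

Lemma measurable_lambda d (T : measurableType d) n (S : T -> 'M[C]_n) k t :
  (forall w, herm (S w)) -> mx_meas S -> (1 <= k <= n)%N ->
  measurable [set w | t <= lambda k (S w)].
Proof.
move=> hS mS kn.
pose c w : R := \sum_(i < n) (t <= eig (S w) i)%R%:R.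
have mc : measurable_fun setT c.
  apply: (@measurable_fun_cvg _ _ _ _
    (fun k w => rtr (fmx (soft_step t k) (S w)))) => [j|w _].
    under eq_fun do rewrite soft_step_fmx //.
    apply: mx_meas_rtr; apply: mx_meas_expR => [w|].
      by apply: hermZ; exact: fmx_herm.
    apply: mx_measZ; apply: mx_meas_expR => [w|].
      by apply: hermD; apply: hermZ => //; exact: herm1.
    by apply: mx_measD; [exact: mx_measZ|exact: mx_meas_cst].
  apply: (cvg_ext (fun=> erefl)
    (esym (rtr_fmx (fun x => (t <= x)%R%:R) (S w)))).
  exact: (@cvg_rtr_fmx R (soft_step t) (fun x => (t <= x)%R%:R) n (S w)
    (@cvg_soft_step t)).
have -> : [set w | t <= lambda k (S w)] = setT `&` c @^-1` `[k%:R, +oo[.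
  rewrite setTI; apply/seteqP; split=> w /=;
    by rewrite in_itv /= andbT /c -natr_sum ler_nat le_lambda.
exact: mc.
Qed.

End Measurability.

(** * Entrywise expectation of complex matrices *)

Section ComplexExpectation.
Context d (T : measurableType d) (R : realType) (P : probability T R).
Local Notation C := R[i].

Definition cint (f : T -> C) :=
  rint P (fun w => complex.Re (f w)) /\ rint P (fun w => complex.Im (f w)).

Definition cexp (f : T -> C) : C :=
  rexp P (fun w => complex.Re (f w)) +i* rexp P (fun w => complex.Im (f w)).

Lemma cint_cst (c : C) : cint (fun=> c).
Proof. by split; exact: rint_cst. Qed.

Lemma cexp_cst (c : C) : cexp (fun=> c) = c.
Proof. by rewrite /cexp !rexp_cst; case: c. Qed.

Lemma cintD f g : cint f -> cint g -> cint (fun w => f w + g w).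
Proof.
move=> [rf jf] [rg jg]; split.
  by under eq_fun do rewrite ReD; exact: rintD.
by under eq_fun do rewrite ImD; exact: rintD.
Qed.

Lemma cexpD f g : cint f -> cint g ->
  cexp (fun w => f w + g w) = cexp f + cexp g.
Proof.
move=> [rf jf] [rg jg]; rewrite /cexp.
under [X in rexp P X]eq_fun do rewrite ReD.
under [X in _ +i* rexp P X]eq_fun do rewrite ImD.
by rewrite !rexpD.
Qed.

Lemma cintZ (c : C) f : cint f -> cint (fun w => c * f w).
Proof.
move=> [rf jf]; split.
  under eq_fun do rewrite ReMc.
  by apply: rintD; [exact: rintZ|apply: rintN; exact: rintZ].
under eq_fun do rewrite ImMc.
by apply: rintD; exact: rintZ.
Qed.

Lemma cexpZ (c : C) f : cint f -> cexp (fun w => c * f w) = c * cexp f.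
Proof.
move=> [rf jf]; rewrite /cexp.
under [X in rexp P X]eq_fun do rewrite ReMc.
under [X in _ +i* rexp P X]eq_fun do rewrite ImMc.
rewrite !rexpD ?rexpN ?rexpZ //;
  try by [exact: rintZ|apply: rintN; exact: rintZ].
by case: c => a b.
Qed.

Lemma cint_sum (I : Type) (r : seq I) (Q : pred I) (F : I -> T -> C) :
  (forall i, Q i -> cint (F i)) -> cint (fun w => \sum_(i <- r | Q i) F i w).
Proof.
move=> Fi; elim: r => [|i r IH].
  by under eq_fun do rewrite big_nil; exact: cint_cst.
under eq_fun do rewrite big_cons.
by case: (boolP (Q i)) => // Qi; apply: cintD => //; exact: Fi.
Qed.

Lemma cexp_sum (I : Type) (r : seq I) (Q : pred I) (F : I -> T -> C) :
  (forall i, Q i -> cint (F i)) ->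
  cexp (fun w => \sum_(i <- r | Q i) F i w) = \sum_(i <- r | Q i) cexp (F i).
Proof.
move=> Fi; elim: r => [|i r IH].
  by rewrite big_nil; under eq_fun do rewrite big_nil; exact: cexp_cst.
rewrite big_cons; under eq_fun do rewrite big_cons.
case: (boolP (Q i)) => // Qi; rewrite cexpD ?IH //; first exact: Fi.
exact: cint_sum.
Qed.

Lemma mx_expectationE m n (X : T -> 'M[C]_(m, n)) a b :
  mx_expectation P X a b = cexp (fun w => X w a b).
Proof. by rewrite mxE. Qed.

Lemma mx_integrable_cst m n (A : 'M[C]_(m, n)) : mx_integrable P (fun=> A).
Proof. by move=> a b; exact: cint_cst. Qed.

Lemma mx_expectation_cst m n (A : 'M[C]_(m, n)) :
  mx_expectation P (fun=> A) = A.
Proof. by apply/matrixP => a b; rewrite mx_expectationE cexp_cst. Qed.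

Lemma mx_integrableD m n (X Y : T -> 'M[C]_(m, n)) :
  mx_integrable P X -> mx_integrable P Y ->
  mx_integrable P (fun w => X w + Y w).
Proof.
move=> Xi Yi a b; suff : cint (fun w => (X w + Y w) a b) by [].
have -> : (fun w => (X w + Y w) a b) = fun w => X w a b + Y w a b.
  by apply/funext => w; rewrite mxE.
exact: cintD (Xi a b) (Yi a b).
Qed.

Lemma mx_expectationD m n (X Y : T -> 'M[C]_(m, n)) :
  mx_integrable P X -> mx_integrable P Y ->
  mx_expectation P (fun w => X w + Y w) =
    mx_expectation P X + mx_expectation P Y.
Proof.
move=> Xi Yi; apply/matrixP => a b; rewrite [RHS]mxE !mx_expectationE.
rewrite -(cexpD (Xi a b) (Yi a b)).
by congr cexp; apply/funext => w; rewrite mxE.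
Qed.

Let sandwichE m n p q (A : 'M[C]_(m, n)) (X : T -> 'M[C]_(n, p))
    (B : 'M[C]_(p, q)) a b :
  (fun w => (A *m X w *m B) a b) =
  fun w => \sum_l \sum_k B l b * A a k * X w k l.
Proof.
apply/funext => w; rewrite mxE; apply: eq_bigr => l _.
rewrite mxE mulr_suml; apply: eq_bigr => k _.
by rewrite mulrC mulrA.
Qed.

Lemma mx_integrable_sandwich m n p q (A : 'M[C]_(m, n)) (X : T -> 'M[C]_(n, p))
    (B : 'M[C]_(p, q)) :
  mx_integrable P X -> mx_integrable P (fun w => A *m X w *m B).
Proof.
move=> Xi a b; suff : cint (fun w => (A *m X w *m B) a b) by [].
rewrite sandwichE; apply: cint_sum => l _; apply: cint_sum => k _.
apply: cintZ; exact: Xi.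
Qed.

Lemma mx_expectation_sandwich m n p q (A : 'M[C]_(m, n)) (X : T -> 'M[C]_(n, p))
    (B : 'M[C]_(p, q)) :
  mx_integrable P X ->
  mx_expectation P (fun w => A *m X w *m B) = A *m mx_expectation P X *m B.
Proof.
move=> Xi; apply/matrixP => a b; rewrite mx_expectationE sandwichE.
have Xc k l c : cint (fun w => c * X w k l) by apply: cintZ; exact: Xi.
rewrite cexp_sum => [|l _]; last by apply: cint_sum => k _.
rewrite mxE; apply: eq_bigr => l _.
rewrite cexp_sum // mxE mulr_suml; apply: eq_bigr => k _.
rewrite cexpZ; last exact: Xi.
by rewrite mx_expectationE -mulrA mulrC.
Qed.

Lemma mx_integrableZ m n (c : R) (X : T -> 'M[C]_(m, n)) :
  mx_integrable P X -> mx_integrable P (fun w => c%:C *: X w).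
Proof.
move=> Xi a b; suff : cint (fun w => (c%:C *: X w) a b) by [].
have -> : (fun w => (c%:C *: X w) a b) = fun w => c%:C * X w a b.
  by apply/funext => w; rewrite mxE.
exact: cintZ (Xi a b).
Qed.

Lemma mx_expectationZ m n (c : R) (X : T -> 'M[C]_(m, n)) :
  mx_integrable P X ->
  mx_expectation P (fun w => c%:C *: X w) = c%:C *: mx_expectation P X.
Proof.
move=> Xi; apply/matrixP => a b; rewrite [RHS]mxE !mx_expectationE.
rewrite -(cexpZ _ (Xi a b)); congr cexp.
by apply/funext => w; rewrite mxE.
Qed.

Definition part (b : bool) (z : C) : R :=
  if b then complex.Im z else complex.Re z.

(** One real coordinate of [f] against one of [h]: a complex product consists of four such real
    products, each treated by [rexpM_indep]. *)
Definition indep_parts (f h : T -> C) := forall b1 b2 (A B : set R),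
  measurable A -> measurable B ->
  P ((part b1 \o f) @^-1` A `&` (part b2 \o h) @^-1` B) =
  (P ((part b1 \o f) @^-1` A) * P ((part b2 \o h) @^-1` B))%E.

Lemma cexpM_indep f h : cint f -> cint h -> indep_parts f h ->
  cint (fun w => f w * h w) /\ cexp (fun w => f w * h w) = cexp f * cexp h.
Proof.
move=> [rf jf] [rh jh] fh.
have [rr1 rr2] := rexpM_indep rf rh (fh false false).
have [ri1 ri2] := rexpM_indep rf jh (fh false true).
have [ir1 ir2] := rexpM_indep jf rh (fh true false).
have [ii1 ii2] := rexpM_indep jf jh (fh true true).
have RE : (fun w => complex.Re (f w * h w)) = fun w =>
  complex.Re (f w) * complex.Re (h w) + - (complex.Im (f w) * complex.Im (h w)).
  by apply/funext => w; rewrite ReMc.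
have IE : (fun w => complex.Im (f w * h w)) = fun w =>
  complex.Re (f w) * complex.Im (h w) + complex.Im (f w) * complex.Re (h w).
  by apply/funext => w; rewrite ImMc.
rewrite /cint /cexp RE IE; split.
  by split; apply: rintD => //; exact: rintN.
rewrite !rexpD //; last exact: rintN.
by rewrite rexpN // rr2 ri2 ir2 ii2.
Qed.

Lemma mx_expectationM_indep m n p (F : T -> 'M[C]_(m, n))
    (Q : T -> 'M[C]_(n, p)) :
  mx_integrable P F -> mx_integrable P Q ->
  (forall a b a' b', indep_parts (fun w => F w a b) (fun w => Q w a' b')) ->
  mx_integrable P (fun w => F w *m Q w) /\
  mx_expectation P (fun w => F w *m Q w) =
    mx_expectation P F *m mx_expectation P Q.
Proof.
move=> Fi Qi FQ.
have E a b : (fun w => (F w *m Q w) a b) = fun w => \sum_k F w a k * Q w k b.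
  by apply/funext => w; rewrite mxE.
have I a b k := cexpM_indep (Fi a k) (Qi k b) (FQ a k k b).
split.
  move=> a b; suff : cint (fun w => (F w *m Q w) a b) by [].
  by rewrite E; apply: cint_sum => k _; case: (I a b k).
apply/matrixP => a b; rewrite mx_expectationE E.
rewrite cexp_sum => [|k _]; last by case: (I a b k).
rewrite mxE; apply: eq_bigr => k _; case: (I a b k) => _ ->.
by rewrite !mx_expectationE.
Qed.

Lemma rexp_rtr n (X : T -> 'M[C]_n) : mx_integrable P X ->
  rint P (fun w => rtr (X w)) /\
  rexp P (fun w => rtr (X w)) = rtr (mx_expectation P X).
Proof.
move=> Xi.
have I : cint (fun w => \tr (X w)) by apply: cint_sum => i _; exact: Xi.
split; first by case: I.
have -> : rexp P (fun w => rtr (X w)) = complex.Re (cexp (fun w => \tr (X w))).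
  by [].
rewrite /mxtrace cexp_sum; last by move=> i _; exact: Xi.
by rewrite /rtr /mxtrace; congr complex.Re; apply: eq_bigr => i _; rewrite mxE.
Qed.
End ComplexExpectation.

(** * Independence through generated sigma-algebras *)

Section Independence.
Context d (T : measurableType d) (R : realType) (P : probability T R).
Local Notation C := R[i].

(** Dynkin's theorem: the sets satisfying the product rule with a fixed [D] are closed under
    complement and disjoint countable union. *)
Lemma g_sigma_algebra_indep (G : set (set T)) (D : set T) :
  setI_closed G -> G `<=` measurable -> measurable D ->
  (forall A, G A -> P (A `&` D) = (P A * P D)%E) ->
  forall A, <<s G >> A -> P (A `&` D) = (P A * P D)%E.
Proof.
move=> GI GM mD GD.
have sGM : <<s G >> `<=` measurable.
  by apply: smallest_sub => //; exact: sigma_algebra_measurable.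
apply: (@dynkin_induction _ (g_sigma_algebraType G) G) => //.
- by rewrite setTI probability_setT mul1e.
- move=> S /sGM mS SD; rewrite setIC -setDE.
  have -> : P (D `\` S) = (P D - P (S `&` D))%E.
    by rewrite (setIC S) measureD // -ge0_fin_numE // fin_num_measure.
  rewrite SD probability_setC // muleBl ?fin_num_measure //.
  by rewrite mul1e.
- move=> F mF tF FD; rewrite setI_bigcupl.
  have mF' i : @measurable d T (F i) by exact: sGM (mF i).
  have mFD i : @measurable d T (F i `&` D) by exact: measurableI.
  have tFD : trivIset setT (fun i => F i `&` D) by exact: trivIset_setIr.
  have PD : P D = (fine (P D))%:E by rewrite fineK // fin_num_measure.
  rewrite !measure_bigcup // muleC PD -nneseriesZl //.
  by apply: eq_eseriesr => i _; apply: etrans (FD i) _; rewrite -PD muleC.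
Qed.

Context (n m : nat) (X : 'I_m -> T -> 'M[C]_n).
Hypotheses (X_random : forall j, random_mx (X j))
  (X_indep : mutually_independent P X).

Definition cylinders (J : {set 'I_m}) : set (set T) :=
  [set A | exists2 B : 'I_m -> set 'M[C]_n, (forall i, mx_borel (B i)) &
     A = [set w | forall i, i \in J -> B i (X i w)]].

(* The sample space with the sigma-algebra generated by the X_j, j in J. *)
Definition gen_by (J : {set 'I_m}) := g_sigma_algebraType (cylinders J).

Let mx_borel_sigma : sigma_algebra setT (@mx_borel R n n).
Proof. exact: smallest_sigma_algebra. Qed.

Lemma mx_borelT : mx_borel (setT : set 'M[C]_n).
Proof.
by have [M0 MD _] := mx_borel_sigma; rewrite -(setD0 setT); exact: MD.
Qed.

Lemma mx_borelI (A B : set 'M[C]_n) :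
  mx_borel A -> mx_borel B -> mx_borel (A `&` B).
Proof.
have [_ MD MU] := mx_borel_sigma => mA mB.
have -> : A `&` B = setT `\` \bigcup_i (setT `\` (if i == 0%N then A else B)).
  apply/seteqP; split=> [w [Aw Bw]|w [_ H]].
    by split=> // -[i _ [_]]; case: eqP.
  split; apply: contrapT => nw; apply: H; [exists 0%N => //|exists 1%N => //];
    by split.
by apply: (MD _); apply: MU => i; apply: MD; case: eqP.
Qed.

Lemma cylinders_setI J : setI_closed (cylinders J).
Proof.
move=> _ _ [A mA ->] [B mB ->]; exists (fun i => A i `&` B i).
  by move=> i; exact: mx_borelI.
apply/seteqP; split=> w /= H; first by case: H => HA HB i iJ; split; auto.
by split=> i /H [].
Qed.

Lemma cylinders_measurable J : cylinders J `<=` measurable.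
Proof.
move=> _ [B mB ->].
have -> : [set w | forall i, i \in J -> B i (X i w)] =
    \bigcap_(i in [set i | i \in J]) (X i @^-1` B i).
  by apply/seteqP; split=> w /= H i; exact: H.
apply: fin_bigcap_measurable => [|i _]; first exact: finite_finset.
exact: X_random.
Qed.

Lemma gen_by_measurable J : <<s cylinders J >> `<=` measurable.
Proof.
apply: smallest_sub; first exact: sigma_algebra_measurable.
exact: cylinders_measurable.
Qed.

(** Dynkin's theorem on one side at a time: the first application fixes [D] and reduces [A] to a
    cylinder, the second fixes that cylinder and reduces [D]. On cylinders the rule is mutual
    independence over [j |: J]. *)
Lemma gen_by_indep (J : {set 'I_m}) j A D : j \notin J ->
  <<s cylinders J >> A -> <<s cylinders [set j]%SET >> D ->
  P (A `&` D) = (P A * P D)%E.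
Proof.
move=> jJ sA sD.
apply: (g_sigma_algebra_indep (@cylinders_setI J) (@cylinders_measurable J)) sA.
  exact: gen_by_measurable sD.
move=> {}A cA; rewrite setIC muleC; move: D sD.
apply: g_sigma_algebra_indep; first exact: cylinders_setI.
- exact: cylinders_measurable.
- exact: cylinders_measurable cA.
case: cA => B mB -> _ [D mD ->].
pose E i := if i == j then D j else B i.
have mE i : mx_borel (E i) by rewrite /E; case: ifP.
have -> : [set w | forall i, i \in [set j]%SET -> D i (X i w)] `&`
   [set w | forall i, i \in J -> B i (X i w)] =
   [set w | forall i, i \in (j |: J)%SET -> E i (X i w)].
  apply/seteqP; split=> w /=.
    move=> [HD HB] i; rewrite !inE /E; case: eqP => [-> _|_ /= iJ].
      by apply: HD; rewrite inE.
    exact: HB.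
  move=> H; split=> i.
    by rewrite inE => /eqP ->; have := H j; rewrite !inE /E eqxx; exact.
  move=> iJ; have := H i; rewrite !inE iJ orbT /E.
  by case: eqP => [ij|_]; [move: jJ; rewrite -ij iJ|exact].
rewrite !X_indep // big_setU1 //= big_set1 /E eqxx; congr (_ * _)%E.
apply: eq_bigr => i iJ; case: eqP => // ij.
by move: jJ; rewrite -ij iJ.
Qed.

Lemma mx_meas_gen_by (J : {set 'I_m}) i :
  i \in J -> @mx_meas R _ (gen_by J) n n (X i).
Proof.
move=> iJ.
have key (B : set 'M[C]_n) : mx_borel B -> <<s cylinders J >> (X i @^-1` B).
  move=> mB; apply: sub_sigma_algebra.
  exists (fun k => if k == i then B else setT).
    by move=> k; case: ifP => // _; exact: mx_borelT.
  apply/seteqP; split=> w /= H; last by have := H i iJ; rewrite eqxx.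
  by move=> k _; case: eqP => // ->.
move=> a b; split=> _ B mB; rewrite setTI.
  apply: (key ((fun M : 'M[C]_n => complex.Re (M a b)) @^-1` B)).
  by apply: sub_sigma_algebra; exists a, b, B; split => //; left.
apply: (key ((fun M : 'M[C]_n => complex.Im (M a b)) @^-1` B)).
by apply: sub_sigma_algebra; exists a, b, B; split => //; right.
Qed.

Lemma mx_meas_of_gen J p q (Y : T -> 'M[C]_(p, q)) :
  @mx_meas R _ (gen_by J) p q Y -> mx_meas Y.
Proof.
move=> mY a b; have [rY iY] := mY a b.
split=> _ B mB; apply: (@gen_by_measurable J).
  by have := rY measurableT _ mB.
by have := iY measurableT _ mB.
Qed.

Lemma mx_meas_indep (J : {set 'I_m}) j p q p' q'
    (F : T -> 'M[C]_(p, q)) (Q : T -> 'M[C]_(p', q')) a b a' b' :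
  j \notin J -> @mx_meas R _ (gen_by J) p q F ->
  @mx_meas R _ (gen_by [set j]%SET) p' q' Q ->
  indep_parts P (fun w => F w a b) (fun w => Q w a' b').
Proof.
move=> jJ mF mQ b1 b2 A B mA mB.
apply: (gen_by_indep jJ).
  have [rF iF] := mF a b.
  case: b1; last by have := rF measurableT _ mA; rewrite setTI.
  by have := iF measurableT _ mA; rewrite setTI.
have [rQ iQ] := mQ a' b'.
case: b2; last by have := rQ measurableT _ mB; rewrite setTI.
by have := iQ measurableT _ mB; rewrite setTI.
Qed.
End Independence.

(** * Comparison for one summand by a quadratic majorant *)

Section BennettStep.
Variable R : realType.
Local Notation C := R[i].

Lemma psdD n (A B : 'M[C]_n) : psd A -> psd B -> psd (A + B).
Proof. by move=> A0 B0 x; rewrite mulmxDr mulmxDl mxE addr_ge0. Qed.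

Lemma psdZ n (c : R) (A : 'M[C]_n) : 0 <= c -> psd A -> psd (c%:C *: A).
Proof.
by move=> c0 A0 x; rewrite -scalemxAr -scalemxAl mxE mulr_ge0 // ler0c.
Qed.

Lemma psd_sandwich m n (V : 'M[C]_(n, m)) (A : 'M[C]_n) :
  psd A -> psd (V^t* *m A *m V).
Proof.
by move=> A0 x; have := A0 (x *m V^t*); rewrite trmxCM trmxCK !mulmxA.
Qed.

Definition mgf_coef (th L : R) := (expR (th * L) - 1 - th * L) / L ^+ 2.

Lemma mgf_coef_ge0 th L : 0 <= mgf_coef th L.
Proof.
rewrite /mgf_coef divr_ge0 ?sqr_ge0 // -addrA -opprD subr_ge0.
exact: expR_ge1Dx.
Qed.

Lemma expR_le_mgf_coef th L x : 0 < th -> 0 < L -> x <= L ->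
  expR (th * x) <= 1 + th * x + mgf_coef th L * x ^+ 2.
Proof.
move=> th0 L0 xL.
have := @expR_taylor2_le R (th * x) (th * L) (mulr_gt0 th0 L0).
rewrite ler_pM2l // => /(_ xL).
suff -> : (expR (th * L) - 1 - th * L) / (th * L) ^+ 2 * (th * x) ^+ 2 =
  mgf_coef th L * x ^+ 2 by [].
by rewrite /mgf_coef; field; rewrite !lt0r_neq0.
Qed.

Definition compress n p (V : 'M[C]_(n, p)) (A : 'M[C]_n) := V^t* *m A *m V.

(** The difference is [V^t* A E A V] with [E = 1 - V V^t*] an orthogonal projection. Hence the
    square of a compression is dominated by the compression of the square, whose expectation is what
    the variance parameter measures. *)
Lemma compress_sqr_psd n p (V : 'M[C]_(n, p)) (A : 'M[C]_n) :
  stiefel V -> herm A ->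
  psd (compress V (A *m A) - compress V A *m compress V A).
Proof.
move=> VV hA; rewrite /compress.
pose E : 'M[C]_n := 1%:M - V *m V^t*.
have hE : E^t* = E by rewrite /E trmxCB trmxC1 trmxCM trmxCK.
have EE : E *m E = E.
  rewrite {1}/E mulmxBl mul1mx /E mulmxBr mulmx1 -(mulmxA V (V^t*)).
  by rewrite (mulmxA (V^t*) V) VV mul1mx subrr subr0.
have -> : V^t* *m (A *m A) *m V - V^t* *m A *m V *m (V^t* *m A *m V) =
    (V^t* *m A *m E) *m (V^t* *m A *m E)^t*.
  rewrite !trmxCM trmxCK hE hA -!mulmxA (mulmxA E E) EE /E mulmxBl mul1mx.
  by rewrite !mulmxBr !mulmxA.
exact: psd_mulJ.
Qed.

(** After Golden-Thompson, the quadratic factor minus the exponential of [th Y], with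
    [Y = compress V X], is a function of [Y] nonnegative on its spectrum plus a nonnegative multiple
    of [compress V (X *m X) - Y *m Y]. This is positive semidefinite, so its trace against
    [fmx expR K] is nonnegative. *)
Lemma bennett_step n p (K : 'M[C]_p) (X : 'M[C]_n) (V : 'M[C]_(n, p)) th L :
  0 < th -> 0 < L -> herm K -> herm X -> stiefel V ->
  lambda_max (compress V X) <= L ->
  rtr (fmx expR (K + th%:C *: compress V X)) <=
  rtr (fmx expR K *m (1%:M + th%:C *: compress V X +
                      (mgf_coef th L)%:C *: compress V (X *m X))).
Proof.
move=> th0 L0 hK hX VV YL; set Y := compress V X.
have hY : herm Y by exact: herm_conj.
apply: le_trans (golden_thompson hK (hermZ th hY)) _.
rewrite -subr_ge0 -rtrB -mulmxBr fmx_expRZ //.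
set g := mgf_coef th L; set W := compress V (X *m X).
have -> : 1%:M + th%:C *: Y + g%:C *: W - fmx (fun x => expR (th * x)) Y =
    fmx (fun x => 1 + th * x + g * x ^+ 2 - expR (th * x)) Y +
    g%:C *: (W - Y *m Y).
  have -> : fmx (fun x => 1 + th * x + g * x ^+ 2 - expR (th * x)) Y =
      1%:M + th%:C *: Y + g%:C *: (Y *m Y) - fmx (fun x => expR (th * x)) Y.
    have E1 : fmx (fun=> 1) Y = 1%:M by exact: fmx1.
    have E2 : fmx (fun x => th * x) Y = th%:C *: Y by rewrite -fmxZ fmx_id.
    have E3 : fmx (fun x => g * (x * x)) Y = g%:C *: (Y *m Y).
      by rewrite -fmxZ -fmxM fmx_id.
    rewrite -E1 -E2 -E3 !fmxD; apply: (canRL (addrK _)); rewrite fmxD.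
    by apply: fmx_ext => i; rewrite subrK expr2.
  rewrite scalerBr; move: (g%:C *: W) (g%:C *: _) (fmx _ Y) (th%:C *: Y).
  by move=> A1 A2 A3 A4; apply/matrixP => i j; rewrite !mxE; ring.
apply: rtr_fmxM_ge0; first by move=> x; exact: expR_ge0.
apply: psdD.
  apply: psd_fmx => i; rewrite subr_ge0 expR_le_mgf_coef //.
  exact: le_trans (eig_le_lambda_max _ hY) YL.
by apply: psdZ; [exact: mgf_coef_ge0|exact: compress_sqr_psd].
Qed.
End BennettStep.

Section MoreExpectation.
Context d (T : measurableType d) (R : realType) (P : probability T R).
Local Notation C := R[i].

Lemma rexp_ge0 (f : T -> R) : (forall w, 0 <= f w) -> 0 <= rexp P f.
Proof. by move=> f0; rewrite /rexp fine_ge0 // expectation_ge0. Qed.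

Lemma rexp_le (f g : T -> R) : rint P f -> rint P g ->
  (forall w, f w <= g w) -> rexp P f <= rexp P g.
Proof.
move=> fi gi fg; rewrite -subr_ge0 -rexpN // -rexpD //; last exact: rintN.
by apply: rexp_ge0 => w; rewrite subr_ge0.
Qed.

Lemma rexp_le_ae (f g : T -> R) : measurable_fun setT f ->
  (forall w, 0 <= f w) -> rint P g -> {ae P, forall w, f w <= g w} ->
  rint P f /\ rexp P f <= rexp P g.
Proof.
move=> mf f0 gi fg; have mg := rint_meas gi.
have fi : rint P f.
  apply/integrableP; split; first exact/measurable_EFinP.
  case/integrableP: (gi) => _; apply: le_lt_trans.
  apply: ae_ge0_le_integral => //.
  - by apply/measurable_EFinP; apply: measurableT_comp.
  - by apply/measurable_EFinP; apply: measurableT_comp.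
  apply: filterS fg => w fgw _ /=.
  by rewrite lee_fin ger0_norm // (le_trans fgw) // ler_norm.
split=> //.
have Di : rint P (fun w => g w + - f w) by apply: rintD => //; exact: rintN.
rewrite -subr_ge0 -rexpN // -rexpD //; last exact: rintN.
rewrite -lee_fin -rexpE //.
rewrite (@ae_eq_integral _ _ _ P setT (fun w => `|g w + - f w|%:E)
  (fun w => (g w + - f w)%:E)) //.
- exact: integral_ge0.
- by move/measurable_int: Di.
- by apply/measurable_EFinP; apply: measurableT_comp => //; exact: rint_meas Di.
apply: filterS fg => w fgw _.
by rewrite ger0_norm // subr_ge0.
Qed.

Lemma psd_mx_expectation n (Z : T -> 'M[C]_n) : (forall w, psd (Z w)) ->
  mx_integrable P Z -> psd (mx_expectation P Z).
Proof.
move=> Z0 Zi x; rewrite -mx_expectation_sandwich // mx_expectationE.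
have Im0 w : complex.Im ((x *m Z w *m x^t*) 0 0) = 0 by exact/ger0_Im/Z0.
rewrite /cexp (_ : (fun w => complex.Im _) = fun=> 0); last exact/funext.
rewrite rexp_cst lecE /= eqxx; apply: rexp_ge0 => w; exact/Re_ge0/Z0.
Qed.

Lemma herm_mx_expectation n (Z : T -> 'M[C]_n) : (forall w, herm (Z w)) ->
  mx_integrable P Z -> herm (mx_expectation P Z).
Proof.
move=> hZ Zi; apply/matrixP => a b; rewrite !mxE.
have E w : Z w a b = ((Z w b a)^*)%R by rewrite -[in LHS]hZ !mxE.
apply/eqP; rewrite eq_complex Re_conjc Im_conjc /=.
apply/andP; split; apply/eqP.
  by congr fine; congr expectation; apply/funext => w; rewrite E Re_conjc.
have [_ ji] := Zi b a.
rewrite -[LHS](rexpN ji) /rexp; congr fine; congr expectation.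
by apply/funext => w; rewrite E Im_conjc.
Qed.
End MoreExpectation.

(** * The tail bound *)

Section MasterBound.
Context (R : realType) (d : measure_display) (Omega : measurableType d)
  (P : probability Omega R) (n m : nat) (X : 'I_m -> Omega -> 'M[R[i]]_n).
Hypotheses (X_random : forall j, random_mx (X j))
  (X_indep : mutually_independent P X)
  (X_herm : forall j w, herm (X j w))
  (X_int : forall j, mx_integrable P (X j))
  (X_mean0 : forall j, mx_expectation P (X j) = 0)
  (X_sq_int : forall j, mx_integrable P (fun w => X j w *m X j w)).
Context (p : nat) (V : 'M[R[i]]_(n, p)) (V_stiefel : stiefel V).
Context (th L : R) (th0 : 0 < th) (L0 : 0 < L).
Hypothesis X_bound :
  {ae P, forall w, forall j, lambda_max (compress V (X j w)) <= L}.

Let g := mgf_coef th L.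
Let Y j w := compress V (X j w).
Let W j := compress V (mx_expectation P (fun w => X j w *m X j w)).
(* In H i the first i summands th Y_j are still random and the others have been
   replaced by g W_j; K j is H j with the j-th summand left out. *)
Let K i w := \sum_(j < m | (j < i)%N) th%:C *: Y j w +
             \sum_(j < m | (i < j)%N) g%:C *: W j.
Let H i w := \sum_(j < m | (j < i)%N) th%:C *: Y j w +
             \sum_(j < m | (i <= j)%N) g%:C *: W j.

Let hsq j w : herm (X j w *m X j w).
Proof. by rewrite /herm trmxCM X_herm. Qed.

Let hY j w : herm (Y j w).
Proof. exact/herm_conj/X_herm. Qed.

Let hW j : herm (W j).
Proof. by apply/herm_conj/herm_mx_expectation => // w. Qed.

Let psdW j : psd (W j).
Proof.
apply/psd_sandwich/psd_mx_expectation => // w.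
by rewrite -{2}(X_herm j w); exact: psd_mulJ.
Qed.

Let hK i w : herm (K i w).
Proof. by apply: hermD; apply: herm_sum => j _; exact: hermZ. Qed.

Let hH i w : herm (H i w).
Proof. by apply: hermD; apply: herm_sum => j _; exact: hermZ. Qed.

Let H_recl (j : 'I_m) w : H j w = K j w + g%:C *: W j.
Proof.
rewrite /H /K -addrA; congr (_ + _); rewrite (bigD1 j) //= addrC; congr (_ + _).
by apply: eq_bigl => k; rewrite ltn_neqAle eq_sym andbC.
Qed.

Let H_recr (j : 'I_m) w : H j.+1 w = K j w + th%:C *: Y j w.
Proof.
rewrite /H /K addrAC; congr (_ + _); rewrite (bigD1 j) //= addrC; congr (_ + _).
by apply: eq_bigl => k; rewrite [RHS]ltn_neqAle ltnS andbC.
Qed.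

(** The variables occurring in [K i]; the index [i] is left out, which makes [K i] independent of
    [X i]. *)
Let J i : {set 'I_m} := [set j : 'I_m | (j < i)%N]%SET.

Let mK i : @mx_meas R _ (gen_by X (J i)) p p (fun w => K i w).
Proof.
apply: mx_measD; last exact: mx_meas_cst.
apply: mx_meas_sum => j ji; apply: mx_measZ.
apply: mx_measM; last exact: mx_meas_cst.
apply: mx_measM; first exact: mx_meas_cst.
by apply: mx_meas_gen_by; rewrite inE.
Qed.

(** The majorant of [bennett_step]: linear in [X j] and its square, so its expectation follows from
    the first two moments. *)
Let Q j w := 1%:M + th%:C *: Y j w + g%:C *: compress V (X j w *m X j w).

Let mQ j : @mx_meas R _ (gen_by X [set j]%SET) p p (fun w => Q j w).
Proof.
have mX : @mx_meas R _ (gen_by X [set j]%SET) n n (X j).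
  by apply: mx_meas_gen_by; rewrite inE.
apply: mx_measD.
  apply: mx_measD; first exact: mx_meas_cst.
  apply: mx_measZ; apply: mx_measM; last exact: mx_meas_cst.
  by apply: mx_measM => //; exact: mx_meas_cst.
apply: mx_measZ; apply: mx_measM; last exact: mx_meas_cst.
by apply: mx_measM; [exact: mx_meas_cst|exact: mx_measM].
Qed.

Let Q_int j : mx_integrable P (Q j).
Proof.
apply: mx_integrableD.
  apply: mx_integrableD; first exact: mx_integrable_cst.
  by apply: mx_integrableZ; exact: mx_integrable_sandwich.
by apply: mx_integrableZ; exact: mx_integrable_sandwich.
Qed.

Let Q_exp j : mx_expectation P (Q j) = 1%:M + g%:C *: W j.
Proof.
have i1 := mx_integrable_sandwich (V^t*) V (X_int j).
have i2 := mx_integrable_sandwich (V^t*) V (X_sq_int j).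
rewrite /Q mx_expectationD; first last.
- exact: mx_integrableZ i2.
- by apply: mx_integrableD; [exact: mx_integrable_cst|exact: mx_integrableZ i1].
rewrite mx_expectationD; first last.
- exact: mx_integrableZ i1.
- exact: mx_integrable_cst.
rewrite (mx_expectationZ th i1) (mx_expectationZ g i2) mx_expectation_cst.
rewrite (mx_expectation_sandwich _ _ (X_int j)) X_mean0 mulmx0 mul0mx.
by rewrite scaler0 addr0 (mx_expectation_sandwich _ _ (X_sq_int j)).
Qed.

(** Integrability is part of the induction: by Klein's inequality and positivity of [W j], the trace
    exponential of [K i] is at most that of [H i], so the induction hypothesis dominates every entry
    of the exponential of [K i]. Independence can then factor the expectation of its product with
    [Q]. *)
Lemma rexp_rtr_expR_le i : (i <= m)%N ->
  rint P (fun w => rtr (fmx expR (H i w))) /\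
  rexp P (fun w => rtr (fmx expR (H i w))) <=
    rtr (fmx expR (\sum_j g%:C *: W j)).
Proof.
have mH k : mx_meas (fun w => H k w).
  apply: mx_measD; last exact: mx_meas_cst.
  apply: mx_meas_sum => j ji; apply: mx_measZ.
  apply: mx_measM; last exact: mx_meas_cst.
  apply: mx_measM; first exact: mx_meas_cst.
  have mXj : @mx_meas R _ (gen_by X [set j]%SET) n n (X j).
    by apply: mx_meas_gen_by; rewrite inE.
  exact: (mx_meas_of_gen X_random mXj).
elim: i => [_|i IH im].
  have -> : (fun w => rtr (fmx expR (H 0 w))) =
      fun=> rtr (fmx expR (\sum_j g%:C *: W j)).
    apply/funext => w; congr (rtr (fmx _ _)).
    apply: etrans (add0r _); congr (_ + _).
    exact: (big_pred0 _ _ _ _ (fun k : 'I_m => ltn0 k)).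
  by split; [exact: rint_cst|rewrite rexp_cst].
have [Hi Hle] := IH (ltnW im); pose j := Ordinal im.
have HE w : H i w = K i w + g%:C *: W j by exact: (H_recl j).
have HE' w : H i.+1 w = K i w + th%:C *: Y j w by exact: (H_recr j).
have hgW : herm (g%:C *: W j) by exact: hermZ.
have kl w := klein_expR (hK i w) hgW.
have eK_le w : rtr (fmx expR (K i w)) <= rtr (fmx expR (H i w)).
  rewrite HE; apply: le_trans (kl w); rewrite lerDl.
  apply: rtr_fmxM_ge0; first by move=> x; exact: expR_ge0.
  by apply: psdZ => //; exact: mgf_coef_ge0.
pose eK w := fmx expR (K i w).
have meK : @mx_meas R _ (gen_by X (J i)) p p eK by exact: mx_meas_expR.
have meK' : mx_meas eK := mx_meas_of_gen X_random meK.
have eKi : mx_integrable P eK.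
  move=> a b; have [rK iK] := meK' a b.
  have cK w : Normc.normc (eK w a b) <= rtr (fmx expR (H i w)).
    exact: le_trans (normc_fmx_expR_le _ _ _) (eK_le w).
  split.
    exact: (rint_le rK (fun w => le_trans (Re_le_normc _) (cK w)) Hi).
  exact: (rint_le iK (fun w => le_trans (Im_le_normc _) (cK w)) Hi).
have jJ : j \notin J i by rewrite inE ltnn.
have [eKQi eKQ] := mx_expectationM_indep eKi (Q_int j)
  (fun a b a' b' => mx_meas_indep X_random X_indep a b a' b' jJ meK (mQ j)).
have [tQi tQ] := rexp_rtr eKQi.
have B_int : mx_integrable P (fun w => eK w *m (1%:M + g%:C *: W j)).
  have := mx_integrable_sandwich 1%:M (1%:M + g%:C *: W j) eKi.
  by under eq_fun do rewrite mul1mx.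
have [tBi tB] := rexp_rtr B_int.
have BE : mx_expectation P (fun w => eK w *m (1%:M + g%:C *: W j)) =
    mx_expectation P eK *m (1%:M + g%:C *: W j).
  have := mx_expectation_sandwich 1%:M (1%:M + g%:C *: W j) eKi.
  by under eq_fun do rewrite mul1mx; rewrite mul1mx.
have QB : rexp P (fun w => rtr (eK w *m Q j w)) =
    rexp P (fun w => rtr (eK w *m (1%:M + g%:C *: W j))).
  have E : mx_expectation P (fun w => eK w *m Q j w) =
      mx_expectation P (fun w => eK w *m (1%:M + g%:C *: W j)).
    exact: etrans eKQ (etrans (congr1 (mulmx _) (Q_exp j)) (esym BE)).
  exact: etrans tQ (etrans (congr1 (@rtr R p) E) (esym tB)).
have [|||Hi' Hle'] := @rexp_le_ae _ _ _ P
    (fun w => rtr (fmx expR (H i.+1 w))) _ _ _ tQi _.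
- exact: (mx_meas_rtr (mx_meas_expR (hH i.+1) (mH i.+1))).
- by move=> w; rewrite rtr_fmx sumr_ge0 // => k _; exact: expR_ge0.
- apply: filterS X_bound => w Xw; rewrite HE'.
  exact: bennett_step.
have BH : rexp P (fun w => rtr (eK w *m (1%:M + g%:C *: W j))) <=
    rexp P (fun w => rtr (fmx expR (H i w))).
  apply: (rexp_le tBi Hi) => w.
  by rewrite mulmxDr mulmx1 rtrD HE; exact: kl.
have le_eq (x y : R) : x = y -> x <= y by move=> ->.
split; first exact: Hi'.
exact: le_trans Hle' (le_trans (le_eq _ _ QB) (le_trans BH Hle)).
Qed.

(** Markov's inequality as a pointwise bound: [expR (th * t)] times the indicator of [A] lies below
    the trace exponential. An abstract [A] lets the event for [lambda k] be used directly. *)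
Lemma tail_le_exp (A : set Omega) t : (0 < p)%N -> measurable A ->
  (forall w, A w -> t <= lambda_max (compress V (\sum_j X j w))) ->
  (P A <= (p%:R * expR (g * lambda_max (\sum_j W j) - th * t))%:E)%E.
Proof.
move=> p0 mA At.
have [fi fle] := rexp_rtr_expR_le (leqnn m).
have HS w : H m w = th%:C *: compress V (\sum_j X j w).
  rewrite /H [X in _ + X]big_pred0 => [|j]; last by rewrite leqNgt ltn_ord.
  rewrite addr0 /compress mulmx_sumr mulmx_suml scaler_sumr.
  by apply: eq_bigl => j; rewrite ltn_ord.
have hS w : herm (compress V (\sum_j X j w)).
  by apply: herm_conj; exact: herm_sum.
have Ai : rint P (\1_A : Omega -> R) by exact: integrable_indic.
have Ae : rexp P (\1_A : Omega -> R) = fine (P A).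
  by rewrite /rexp expectation_indic.
have : rexp P (fun w => expR (th * t) * \1_A w) <=
    rexp P (fun w => rtr (fmx expR (H m w))).
  apply: (rexp_le (rintZ (expR (th * t)) Ai) fi) => w.
  rewrite indicE; have [/set_mem Aw|_] := boolP (w \in A).
    rewrite mulr1 HS (fmx_expRZ th (hS w)).
    apply: le_trans (expR_lambda_max_le p0 (ltW th0) (hS w)).
    by rewrite ler_expR ler_pM2l //; exact: At.
  by rewrite mulr0 rtr_fmx sumr_ge0 // => k _; exact: expR_ge0.
rewrite rexpZ // Ae => /le_trans /(_ fle).
rewrite -scaler_sumr.
have hWs : herm (\sum_j W j) by exact: herm_sum.
rewrite (fmx_expRZ g hWs) => /le_trans.
move=> /(_ _ (rtr_expR_le (mgf_coef_ge0 th L) hWs)) PA.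
rewrite -(@fineK _ (P A)) ?fin_num_measure // lee_fin.
rewrite expRD expRN mulrA ler_pdivlMr ?expR_gt0 // mulrC.
exact: PA.
Qed.
End MasterBound.

(** * Optimisation of the exponent and its simplifications *)

Section ScalarBounds.
Variable R : realType.
Implicit Types (s L t th : R).

(** [expR (th * L) = 1 + L * t / s] is the critical point: the left side has derivative
    [s * (expR (th * L) - 1) / L - t] in [th]. *)
Lemma mgf_coef_bennett s L t : 0 < s -> 0 < L -> 0 <= t ->
  let th := ln (1 + L * t / s) / L in
  mgf_coef th L * s - th * t = - (s / L ^+ 2) * bennett (L * t / s).
Proof.
move=> s0 L0 t0 th.
have u0 : 0 <= L * t / s by rewrite divr_ge0 ?(ltW s0) // mulr_ge0 // ltW.
have e : expR (th * L) = 1 + L * t / s.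
  by rewrite /th divfK ?gt_eqF // lnK // posrE; lra.
rewrite /mgf_coef e /bennett /th; field.
by rewrite !lt0r_neq0.
Qed.

Lemma bennett_bernstein s L t : 0 < s -> 0 < L -> 0 <= t ->
  - (s / L ^+ 2) * bennett (L * t / s) <= (- t ^+ 2 / 2) / (s + L * t / 3).
Proof.
move=> s0 L0 t0.
have Lt0 : 0 <= L * t by rewrite mulr_ge0 // ltW.
have u0 : 0 <= L * t / s by rewrite divr_ge0 // ltW.
have c0 : 0 <= s / L ^+ 2 by rewrite divr_ge0 ?sqr_ge0 // ltW.
have -> : (- t ^+ 2 / 2) / (s + L * t / 3) =
    - (s / L ^+ 2) * ((L * t / s) ^+ 2 / 2 / (1 + (L * t / s) / 3)).
  by field; do ![apply/andP; split]; apply: lt0r_neq0; lra.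
by rewrite !mulNr lerN2 ler_wpM2l // bennett_ge.
Qed.

(** Here [L * t <= s], so the denominator is at most [4 s / 3], and [3 / 8] is [(1 / 2) / (4 / 3)].
    For large [t] the same constant comes from [s <= L * t]. *)
Lemma bernstein_small s L t : 0 < s -> 0 < L -> 0 <= t -> t <= s / L ->
  (- t ^+ 2 / 2) / (s + L * t / 3) <= - (3 / 8) * t ^+ 2 / s.
Proof.
move=> s0 L0 t0; rewrite ler_pdivlMr // => tL.
have Lt0 : 0 <= L * t by rewrite mulr_ge0 // ltW.
have D0 : 0 < s + L * t / 3 by lra.
rewrite ler_pdivrMr // mulrAC ler_pdivlMr //.
have := sqr_ge0 t; nra.
Qed.

Lemma bernstein_large s L t : 0 < s -> 0 < L -> s / L <= t ->
  (- t ^+ 2 / 2) / (s + L * t / 3) <= - (3 / 8) * t / L.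
Proof.
move=> s0 L0; rewrite ler_pdivrMr // => tL.
have t0 : 0 < t by rewrite -(pmulr_lgt0 _ L0); lra.
have Lt0 : 0 < L * t by rewrite mulr_gt0.
have D0 : 0 < s + L * t / 3 by lra.
rewrite ler_pdivrMr // mulrAC ler_pdivlMr //.
nra.
Qed.
End ScalarBounds.

Theorem theorem5p1 (R : realType) (d : measure_display)
    (Omega : measurableType d) (P : probability Omega R)
    (n m : nat) (X : 'I_m -> Omega -> 'M[R[i]]_n)
    (X_random : forall j, random_mx (X j))
    (X_indep : mutually_independent P X)
    (X_herm : forall j w, X j w \is hermsymmx)
    (X_int : forall j, mx_integrable P (X j))
    (X_mean0 : forall j, mx_expectation P (X j) = 0)
    (X_sq_int : forall j, mx_integrable P (fun w => X j w *m X j w))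
    (Psi : forall p : nat, 'M[R[i]]_(n, p) -> R)
    (Psi_bound : forall (p : nat) (V : 'M[R[i]]_(n, p)),
        (1 <= p <= n)%N -> stiefel V ->
        {ae P, forall w, forall j,
           lambda_max (V ^t* *m X j w *m V) <= Psi p V})
    (k : nat) (k_range : (1 <= k <= n)%N)
    (sigma2 : R)
    (sigma2_def : sigma2 =
        lambda k (\sum_(j < m) mx_expectation P (fun w => X j w *m X j w)))
    (Vp : 'M[R[i]]_(n, n - k + 1)) (Vp_stiefel : stiefel Vp)
    (Vp_choice : sigma2 =
        lambda_max (\sum_(j < m)
          Vp ^t* *m mx_expectation P (fun w => X j w *m X j w) *m Vp))
    (sigma2_gt0 : 0 < sigma2) (Psi_gt0 : 0 < Psi _ Vp)
    (t : R) (t_ge0 : 0 <= t) :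
  [/\ (P [set w | (t <= lambda k (\sum_(j < m) X j w))%R] <=
        ((n - k + 1)%:R *
         expR (- (sigma2 / Psi _ Vp ^+ 2) *
               bennett (Psi _ Vp * t / sigma2)))%R%:E)%E,
      (n - k + 1)%:R *
        expR (- (sigma2 / Psi _ Vp ^+ 2) * bennett (Psi _ Vp * t / sigma2)) <=
      (n - k + 1)%:R *
        expR ((- t ^+ 2 / 2) / (sigma2 + Psi _ Vp * t / 3)),
      t <= sigma2 / Psi _ Vp ->
        (n - k + 1)%:R *
          expR ((- t ^+ 2 / 2) / (sigma2 + Psi _ Vp * t / 3)) <=
        (n - k + 1)%:R * expR (- (3 / 8) * t ^+ 2 / sigma2)
    & sigma2 / Psi _ Vp <= t ->
        (n - k + 1)%:R *
          expR ((- t ^+ 2 / 2) / (sigma2 + Psi _ Vp * t / 3)) <=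
        (n - k + 1)%:R * expR (- (3 / 8) * t / Psi _ Vp)].
Proof.
set L := Psi _ Vp in Psi_gt0 *.
have s0 := sigma2_gt0; have L0 := Psi_gt0.
have d0 : 0 <= (n - k + 1)%:R :> R by rewrite ler0n.
split; first last.
- by move=> tL; rewrite ler_wpM2l // ler_expR bernstein_large.
- by move=> tL; rewrite ler_wpM2l // ler_expR bernstein_small.
- by rewrite ler_wpM2l // ler_expR bennett_bernstein.
have X_hm j w : herm (X j w) by exact/hermP/X_herm.
have [k1 kn] := andP k_range.
have p0 : (0 < n - k + 1)%N by rewrite addn1.
have pn : (1 <= n - k + 1 <= n)%N.
  by rewrite p0 addn1 -subSn // leq_subLR -add1n leq_add2r.
set A := [set w | _].
have mA : measurable A.
  apply: measurable_lambda => //; first by move=> w; exact: herm_sum.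
  apply: mx_meas_sum => j _.
  have mXj : @mx_meas R _ (gen_by X [set j]%SET) n n (X j).
    by apply: mx_meas_gen_by; rewrite inE.
  exact: (mx_meas_of_gen X_random mXj).
(* At [t = 0] the optimal [th] is 0, outside the range [0 < th] of [tail_le_exp]; the bound is then
   [n - k + 1 >= 1], which exceeds or equals any probability. *)
have [t0|t0] := eqVneq t 0.
  rewrite t0 mulr0 mul0r /bennett addr0 ln1 mulr0 subr0 mulr0 expR0 mulr1.
  by apply: le_trans (probability_le1 _ mA) _; rewrite lee_fin ler1n addn1.
have tpos : 0 < t by rewrite lt_neqAle eq_sym t0.
have u0 : 0 < L * t / sigma2 by rewrite divr_gt0 // mulr_gt0.
pose th := ln (1 + L * t / sigma2) / L.
have th0 : 0 < th by rewrite divr_gt0 // ln_gt0 // ltrDl.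
have := tail_le_exp X_random X_indep X_hm X_int X_mean0 X_sq_int Vp_stiefel th0
  L0 (Psi_bound _ _ pn Vp_stiefel) p0 mA.
move=> /(_ t); rewrite -Vp_choice mgf_coef_bennett //; apply.
move=> w /= tw; apply: le_trans tw _.
by apply: courant_fischer_le => //; exact: herm_sum.
Qed.
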